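(* Let $N_t\ge 2$, $L\in\{1,\dots,N_t\}$ and $N_{RF}\in\{1,\dots,L\}$ be integers and let $\alpha>0$. Consider the random beam-domain channel $(\bar h_1,\dots,\bar h_{N_t})$ and the IT-SU interleaved training scheme with parameters $N_t,L,N_{RF},\alpha$ described in the context, and let $T$ be its (random) training length. Then the average training length $T_{\text{IT-SU}}\triangleq \mathrm{E}[T]$ equals $$T_{\text{IT-SU}}=N_t-\sum_{i=1}^{N_t-1}(N_t-i)P_i,$$ where $P_1=\frac{L}{N_t}e^{-L\alpha/N_t}$ and, for $i=2,\dots,N_t-1$: if $N_{RF}=1$, $$P_i=\sum_{j=b_i^{(1)}}^{b_i^{(2)}}\xi(i,j)\,e^{-L\alpha/N_t}\left(1-e^{-L\alpha/N_t}\right)^j;$$ if $1<N_{RF}\le L$, $$P_i=\sum_{j=b_i^{(1)}}^{\min(N_{RF}-1,\,b_i^{(2)})}\xi(i,j)\,\frac{(L\alpha/N_t)^j e^{-L\alpha/N_t}}{j!}+\sum_{j=\max(N_{RF},\,b_i^{(1)})}^{b_i^{(2)}}\xi(i,j)\left(P_j^{(1)}+P_j^{(2)}\right),$$ with $$P_j^{(1)}=\left(\frac{1-N_{RF}}{L}\right)^{N_{RF}}\frac{e^{-L\alpha/N_t}}{N_{RF}-1}\sum_{l=0}^{j-N_{RF}}\beta_{j,l}\sum_{m=0}^{N_{RF}-2}\binom{N_{RF}-2}{m}\frac{(-1)^m}{(l+1)^{N_{RF}}}\cdot\frac{\left[t^{m+1}\Upsilon(N_{RF}-1-m,t)+\Gamma(N_{RF},t)\right]_{t=0}^{t=\frac{L\alpha(l+1)}{N_tN_{RF}}}}{m+1},$$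 $$P_j^{(2)}=\left(\frac{1-N_{RF}}{L}\right)^{N_{RF}}\frac{-e^{-L\alpha/N_t}}{(N_{RF}-1)^2}\sum_{l=0}^{j-N_{RF}}\beta_{j,l}\sum_{m=0}^{N_{RF}-2}\binom{N_{RF}-2}{m}\frac{1}{(N_{RF}-1)^m(l+1)^{N_{RF}}}\sum_{n=0}^{m}\binom{m}{n}\left(\frac{-L\alpha(l+1)}{N_t}\right)^n\frac{\left[t^{m-n+1}\Upsilon(N_{RF}-1-m,t)+\Gamma(N_{RF}-n,t)\right]_{t=\frac{L\alpha(l+1)}{N_tN_{RF}}}^{t=0}}{m-n+1}.$$
   Context: Channel model: a random subset $\mathcal I\subset\{1,\dots,N_t\}$ with $|\mathcal I|=L$ is drawn uniformly among all $L$-element subsets; conditionally on $\mathcal I$, the coefficients $\bar h_i$, $i\in\mathcal I$, are i.i.d. circularly symmetric complex Gaussian $\mathcal{CN}(0,1/L)$, and $\bar h_i=0$ for $i\notin\mathcal I$. IT-SU scheme: for $i=1,2,\dots,N_t$ in order, beam $i$ is trained, i.e. $\bar h_i$ becomes known. After step $i$, let $\mathcal B_i=\{l\le i:\bar h_l\neq 0\}$, $L_{B_i}=\min(N_{RF},|\mathcal B_i|)$, and let $\mathcal S_i\subset\mathcal B_i$ be the indices of the $L_{B_i}$ elements of $\mathcal B_i$ with largest $|\bar h_l|$. The training terminates at step $i$ if $\bar h_i\ne 0$ and $\sum_{l\in\mathcal S_i}|\bar h_l|^2>\alpha/N_t$; otherwise it proceeds to step $i+1$. The training length $T$ is the step at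 which the training terminates, and $T=N_t$ if it never terminates. Notation: $\xi(i,j)=\binom{i-1}{j}\binom{N_t-i}{L-j-1}/\binom{N_t}{L}$; $b_i^{(1)}=\max\{0,L-1-N_t+i\}$, $b_i^{(2)}=\min\{i-1,L-1\}$; $\beta_{j,l}=\frac{(-1)^l j!\,L^{N_{RF}}}{(j-N_{RF}-l)!\,(N_{RF}-1)!\,(N_{RF}-2)!\,l!}$ for $0\le l\le j-N_{RF}$. $\Upsilon(s,x)=\int_0^x t^{s-1}e^{-t}dt$ is the lower and $\Gamma(s,x)=\int_x^\infty t^{s-1}e^{-t}dt$ the upper incomplete gamma function. For a function $f$, $[f(t)]_{t=a}^{t=b}=f(b)-f(a)$. *)

(* Defs.v *)
From HB Require Import structures.
From mathcomp Require Import all_boot all_order all_algebra.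
From mathcomp Require Import all_classical all_reals all_analysis.
Set Implicit Arguments. Unset Strict Implicit. Unset Printing Implicit Defensive.
Import Order.TTheory GRing.Theory Num.Theory.
Local Open Scope classical_set_scope.
Local Open Scope ring_scope.

Section ITSU.
Variable R : realType.

(* A complex number is represented as the pair (Re, Im). *)
Definition sqnorm (z : R * R) : R := z.1 ^+ 2 + z.2 ^+ 2.

(* Density (w.r.t. Lebesgue measure on R^2) of a circularly symmetric complex
   Gaussian CN(0, 1/L): (L/pi) exp(-L |z|^2). *)
Definition cn_pdf (L : nat) (x y : R) : R :=
  L%:R / pi * expR (- (L%:R * (x ^+ 2 + y ^+ 2))).

(* Expectation of a nonnegative function f of n i.i.d. CN(0,1/L) complex
   variables g = [:: g_1; ...; g_n], written as the iterated integral of f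
   against the product density. *)
Fixpoint cn_expect (L n : nat) (f : seq (R * R) -> \bar R) : \bar R :=
  match n with
  | 0 => f [::]
  | n'.+1 =>
      (\int[@lebesgue_measure R]_x \int[@lebesgue_measure R]_y
         ((cn_pdf L x y)%:E * cn_expect L n' (fun s => f ((x, y) :: s))))%E
  end.

(* Beam-domain channel, indices i = 1..Nt (1-based as in the paper).
   The support is I (an L-subset of 'I_Nt, element k standing for index k+1);
   the nonzero coefficients are the entries of g, assigned in increasing order
   of the support indices; all other coefficients are 0. *)
Definition chan (Nt : nat) (I : {set 'I_Nt}) (g : seq (R * R)) (i : nat) : R * R :=
  let s := [seq (val k).+1 | k <- enum I] in
  if i \in s then nth (0, 0) g (index i s) else (0, 0).

Definition Bsq (h : nat -> R * R) (i : nat) : seq R :=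
  [seq sqnorm (h l) | l <- [seq l <- iota 1 i | h l != (0, 0)]].

Definition topsum (NRF : nat) (s : seq R) : R :=
  \sum_(x <- take NRF (sort (fun a b => b <= a) s)) x.

Definition stops (Nt NRF : nat) (alpha : R) (h : nat -> R * R) (i : nat) : bool :=
  (h i != (0, 0)) && (alpha / Nt%:R < topsum NRF (Bsq h i)).

Definition train_len (Nt NRF : nat) (alpha : R) (h : nat -> R * R) : nat :=
  nth Nt [seq i <- iota 1 Nt | stops Nt NRF alpha h i] 0.

Definition avg_train_len (Nt L NRF : nat) (alpha : R) : \bar R :=
  ((\sum_(I : {set 'I_Nt} | #|I| == L)
      cn_expect L L (fun g => (train_len Nt NRF alpha (chan I g))%:R%:E))
   * (('C(Nt, L))%:R^-1)%:E)%E.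

Definition lower_inc_gamma (s : nat) (x : R) : R :=
  fine (\int[@lebesgue_measure R]_(t in [set t : R | (0 <= t <= x)%R])
          ((t ^+ s.-1 * expR (- t))%R)%:E)%E.

Definition upper_inc_gamma (s : nat) (x : R) : R :=
  fine (\int[@lebesgue_measure R]_(t in [set t : R | (x <= t)%R])
          ((t ^+ s.-1 * expR (- t))%R)%:E)%E.

Definition xi (Nt L i j : nat) : R :=
  ('C(i.-1, j) * 'C(Nt - i, L - j.+1))%:R / ('C(Nt, L))%:R.

(* b_i^(1) = max{0, L-1-Nt+i}  (truncated subtraction, L >= 1) *)
Definition b1 (Nt L i : nat) : nat := (L.-1 + i) - Nt.
Definition b2 (L i : nat) : nat := minn i.-1 L.-1.

Definition beta (L NRF j l : nat) : R :=
  (-1) ^+ l * (j`!)%:R * L%:R ^+ NRF /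
  (((j - NRF - l)`!)%:R * ((NRF.-1)`!)%:R * ((NRF.-2)`!)%:R * (l`!)%:R).

Definition cst (Nt L : nat) (alpha : R) : R := L%:R * alpha / Nt%:R.

Definition Pj1 (Nt L NRF : nat) (alpha : R) (j : nat) : R :=
  let c := cst Nt L alpha in
  ((1 - NRF%:R) / L%:R) ^+ NRF * expR (- c) / (NRF%:R - 1) *
  \sum_(0 <= l < (j - NRF).+1) beta L NRF j l *
    \sum_(0 <= m < (NRF.-2).+1)
      'C(NRF.-2, m)%:R * (-1) ^+ m / (l.+1)%:R ^+ NRF *
      (let F := fun t : R =>
          t ^+ m.+1 * lower_inc_gamma (NRF.-1 - m) t + upper_inc_gamma NRF t in
       (F (L%:R * alpha * (l.+1)%:R / (Nt%:R * NRF%:R)) - F 0) / (m.+1)%:R).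

Definition Pj2 (Nt L NRF : nat) (alpha : R) (j : nat) : R :=
  let c := cst Nt L alpha in
  ((1 - NRF%:R) / L%:R) ^+ NRF * (- expR (- c)) / (NRF%:R - 1) ^+ 2 *
  \sum_(0 <= l < (j - NRF).+1) beta L NRF j l *
    \sum_(0 <= m < (NRF.-2).+1)
      'C(NRF.-2, m)%:R / ((NRF%:R - 1) ^+ m * (l.+1)%:R ^+ NRF) *
      \sum_(0 <= n < m.+1)
        'C(m, n)%:R * (- (L%:R * alpha * (l.+1)%:R / Nt%:R)) ^+ n *
        (let G := fun t : R =>
            t ^+ (m - n).+1 * lower_inc_gamma (NRF.-1 - m) t
            + upper_inc_gamma (NRF - n) t in
         (G 0 - G (L%:R * alpha * (l.+1)%:R / (Nt%:R * NRF%:R))) / ((m - n).+1)%:R).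

Definition Pi (Nt L NRF : nat) (alpha : R) (i : nat) : R :=
  let c := cst Nt L alpha in
  if i == 1%N then L%:R / Nt%:R * expR (- c)
  else if NRF == 1%N then
    \sum_(b1 Nt L i <= j < (b2 L i).+1)
       xi Nt L i j * expR (- c) * (1 - expR (- c)) ^+ j
  else
    \sum_(b1 Nt L i <= j < (minn NRF.-1 (b2 L i)).+1)
       xi Nt L i j * (c ^+ j * expR (- c) / (j`!)%:R)
    + \sum_(maxn NRF (b1 Nt L i) <= j < (b2 L i).+1)
       xi Nt L i j * (Pj1 Nt L NRF alpha j + Pj2 Nt L NRF alpha j).

Definition T_ITSU_formula (Nt L NRF : nat) (alpha : R) : R :=
  Nt%:R - \sum_(1 <= i < Nt) (Nt - i)%:R * Pi Nt L NRF alpha i.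

End ITSU.

(* Main.v *)
(** Only the squared moduli of the nonzero coefficients matter, and after scaling
    by [L] they are i.i.d. standard exponential variables (polar coordinates).
    Training stops at the [k+1]-st beam of the support exactly when the sum of the
    [NRF] largest of these variables crosses [c = L * alpha / Nt] at the [k+1]-st
    variable, an event whose probability [p_k] does not depend on the support.
    The number of supports of size [L] whose [k+1]-st element is [i] being
    [C(i-1,k) C(Nt-i,L-k-1)], one gets [E T = Nt - sum_i (Nt-i) sum_k xi(i,k) p_k].

    To compute [p_k], condition on the minimum [y] of the first [k] variables: the
    excesses over it are again i.i.d. exponential and independent of it, and for
    [k >= NRF] subtracting [y] lowers the sum of the [NRF] largest by [NRF * y].
    This gives an integral recursion in [k], started at [k < NRF] where the sum of the
    largest is the full sum, and solved by
    [k!/((k-N)! (N-1)!^2) e^-c int_0^(c/N) (1-e^-w)^(k-N) e^-w (c-N w)^(N-1) dw]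
    for [N = NRF]. Expanding [(1-e^-w)^(k-N)], each term is a multiple of
    [int_0^a (a-t)^(N-1) e^-t dt] with [a = c(l+1)/N], and the incomplete gamma
    expressions [P^(1)] and [P^(2)] are binomial expansions of multiples of the same
    integral. *)
Require Import Defs.
From HB Require Import structures.
From mathcomp Require Import all_boot all_order all_algebra.
From mathcomp Require Import all_classical all_reals all_analysis.
From mathcomp Require Import measurable_realfun.
From mathcomp Require Import zify ring lra.
Set Implicit Arguments. Unset Strict Implicit. Unset Printing Implicit Defensive.
Import Order.TTheory GRing.Theory Num.Theory.
Import numFieldNormedType.Exports.
Local Open Scope classical_set_scope.
Local Open Scope ring_scope.

(** * Integration by substitution and polar coordinates *)

Section calculus.
Context {R : realType}.
Local Notation mu := (@lebesgue_measure R).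

(** The expectation is an iterated integral, so independence enters only through Tonelli's theorem
    and substitutions in one variable. Selecting the largest entries by sorting does not fit an
    integral that peels off one variable at a time. The recursion
    [max (tops s N) (x + tops s (N-1))] does, and it shows directly which values of the newest
    variable [x] cross the threshold. The conditioning is on the minimum because, once at least [N]
    entries are present, removing it lowers each selected entry by the same amount: the problem
    keeps its form with a smaller threshold. Neither [Pj1] nor [Pj2] alone is the stopping
    probability. Up to a common factor their coefficients of the shared integral are [1] and
    [(N/(N-1))^(N-1) - 1], so the two units cancel in the sum. *)

Lemma is_derive_continuous (F f : R -> R) :
  (forall x, is_derive x (1 : R) F (f x)) -> continuous F.
Proof.
move=> dF x; apply: differentiable_continuous; apply/derivable1_diffP.
by have [] := dF x.
Qed.

Lemma integral_FTC (f F : R -> R) a b : a <= b -> continuous f ->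
  (forall x, is_derive x (1 : R) F (f x)) ->
  (\int[mu]_(x in `[a, b]) (f x)%:E = (F b - F a)%:E)%E.
Proof.
rewrite le_eqVlt => /predU1P[-> cf dF|ab cf dF].
  by rewrite set_itv1 integral_set1 subrr.
have cF := is_derive_continuous dF.
rewrite (continuous_FTC2 (F := F)) //.
- exact: continuous_subspaceT.
- split; first by move=> x _; have [] := dF x.
  + exact/cvg_at_right_filter/cF.
  + exact/cvg_at_left_filter/cF.
- by move=> x _; rewrite derive1E; have [] := dF x.
Qed.

End calculus.

(** * Image of a measure with density *)

Section integral_density.
Context d1 d2 (T1 : measurableType d1) (T2 : measurableType d2) (R : realType).
Variables (m1 : {measure set T1 -> \bar R}) (m2 : {measure set T2 -> \bar R}).
Variables (phi : T1 -> T2) (w : T1 -> R).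
Hypotheses (mphi : measurable_fun setT phi) (mw : measurable_fun setT w).
Hypothesis w0 : forall x, 0 <= w x.
Hypothesis m2E : forall A, measurable A ->
  (m2 A = \int[m1]_(x in phi @^-1` A) (w x)%:E)%E.

Import HBNNSimple.

(** Hypothesis [m2E] says that [m2] is the image under [phi] of the measure with density [w], which
    is the claim for indicators. Both sides are monotone limits along the simple functions [g_ n]
    increasing to [G], so linearity and monotone convergence do the rest. *)
Lemma ge0_integral_density (G : T2 -> \bar R) :
  measurable_fun setT G -> (forall y, 0 <= G y)%E ->
  (\int[m2]_y G y = \int[m1]_x ((w x)%:E * G (phi x)))%E.
Proof.
move=> mG G0.
pose g_ := nnsfun_approx measurableT mG.
have mgphi n : measurable_fun setT (fun x => (w x * g_ n (phi x))%:E).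
  apply/measurable_EFinP; apply: measurable_funM => //.
  exact: measurableT_comp.
transitivity (limn (fun n => \int[m2]_x (g_ n x)%:E))%E.
  rewrite -monotone_convergence//.
  - apply: eq_integral => y _; apply/esym/cvg_lim => //.
    exact: cvg_nnsfun_approx.
  - by move=> n; exact/measurable_EFinP/measurable_funP.
  - by move=> n y _; rewrite lee_fin.
  - by move=> y _ m n mn; rewrite lee_fin; exact/lefP/nd_nnsfun_approx.
transitivity (limn (fun n => \int[m1]_x (w x * g_ n (phi x))%:E))%E; last first.
  rewrite -monotone_convergence//.
  - apply: eq_integral => y _; apply/cvg_lim => //.
    under eq_fun do rewrite EFinM.
    apply: cvgeZl => //.
    exact: cvg_nnsfun_approx.
  - by move=> n y _; rewrite lee_fin mulr_ge0.
  - move=> y _ m n mn; rewrite lee_fin ler_wpM2l//; exact/lefP/nd_nnsfun_approx.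
congr (limn _); apply/funext => n.
have msub r : measurable (g_ n @^-1` [set r]) by exact: measurable_funPTI.
transitivity (\sum_(r \in range (g_ n)) (r%:E * m2 (g_ n @^-1` [set r])))%E.
  under eq_integral do rewrite fimfunE -fsumEFin//.
  rewrite ge0_integral_fsum//; last 2 first.
  - by move=> y; exact/measurable_EFinP/measurable_funM.
  - by move=> y x _; rewrite nnfun_muleindic_ge0.
  apply: eq_fsbigr => r _.
  by rewrite integralZl_indic_nnsfun// integral_indic// setIT.
transitivity (\sum_(r \in range (g_ n))
   \int[m1]_x (r * \1_(g_ n @^-1` [set r]) (phi x) * w x)%:E)%E.
  apply: eq_fsbigr => r; rewrite inE => -[y _ gr].
  have r0 : 0 <= r by rewrite -gr.
  under eq_integral do rewrite -mulrA EFinM.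
  rewrite ge0_integralZl//; last 2 first.
  - apply/measurable_EFinP; apply: measurable_funM => //.
    exact: measurableT_comp.
  - by move=> x _; rewrite lee_fin mulr_ge0.
  rewrite m2E//; congr (_ * _)%E; rewrite integral_mkcond.
  apply: eq_integral => x _; rewrite patchE /= indicE.
  have -> : (x \in phi @^-1` (g_ n @^-1` [set r])) =
      (phi x \in g_ n @^-1` [set r]) by apply/idP/idP; rewrite !inE.
  by case: ifP => _; rewrite /= ?mul1r ?mul0r.
rewrite -ge0_integral_fsum//.
- apply: eq_integral => x _.
  rewrite fsumEFin// [in RHS]fimfunE mulrC mulr_fsuml//.
- move=> r; apply: measurableT_comp => //; apply: measurable_funM => //.
  apply: measurable_funM => //.
  exact: measurableT_comp.
- move=> r x _; rewrite lee_fin mulr_ge0//.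
  by have := nnfun_muleindic_ge0 (g_ n) r (phi x); rewrite -EFinM lee_fin.
Qed.

End integral_density.

(** * Nondecreasing substitutions on the whole line *)

Section ge0_substitution.
Context {R : realType}.
Local Notation mu := (@lebesgue_measure R).
Variables phi psi w : R -> R.
Hypothesis dphi : forall x, is_derive x (1 : R) phi (w x).
Hypothesis cw : continuous w.
Hypothesis w0 : forall x, 0 <= w x.
Hypothesis phi_psi : forall x y, (x <= psi y) = (phi x <= y).
Hypothesis psiK : cancel psi phi.

Let mphi : measurable_fun [set: R] phi.
Proof. by apply: continuous_measurable_fun; exact: is_derive_continuous dphi. Qed.

Let mw : measurable_fun [set: R] w.
Proof. exact: continuous_measurable_fun. Qed.

Let mpre (A : set R) : measurable A -> measurable (phi @^-1` A).
Proof. by move=> mA; rewrite -[X in measurable X]setTI; exact: mphi. Qed.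

Let nu (A : set (measurableTypeR R)) : \bar R :=
  (\int[mu]_(x in phi @^-1` A) (w x)%:E)%E.

Let nu0 : nu set0 = 0%E.
Proof. by rewrite /nu preimage_set0 integral_set0. Qed.

Let nu_ge0 A : (0 <= nu A)%E.
Proof. by apply: integral_ge0 => x _; rewrite lee_fin. Qed.

Let nu_sigma_additive : semi_sigma_additive nu.
Proof.
move=> F mF tF mUF; rewrite /nu preimage_bigcup.
rewrite [X in _ --> X]ge0_integral_bigcup//=.
- apply: is_cvg_ereal_nneg_natsum_cond => n _ _.
  by apply: integral_ge0 => x _; rewrite lee_fin.
- by move=> n; apply: mpre; exact: mF.
- by apply/measurable_EFinP; exact: measurable_funTS.
- by move=> x _; rewrite lee_fin.
- by move=> i j _ _ [x [/= xi xj]]; apply: tF => //; exists (phi x).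
Qed.

HB.instance Definition _ := isMeasure.Build _ _ _ nu nu0 nu_ge0 nu_sigma_additive.

(** Lebesgue measure is determined by the intervals []a, b]]. The Galois connection [phi_psi] makes
    the preimage of such an interval equal to []psi a, psi b]], over which [w] integrates to
    [phi (psi b) - phi (psi a) = b - a]. The derivative [w] may vanish, as that of [x |x|] does at
    0. *)
Let nuE (A : set R) : measurable A -> mu A = nu A.
Proof.
apply: lebesgue_measure_unique => _ [[a b] _ <-] /=.
rewrite /nu lebesgue_measure_itv/= lte_fin.
have -> : phi @^-1` `]a, b] = `]psi a, psi b]%classic.
  by apply/seteqP; split=> x /=; rewrite !in_itv/= !ltNge !phi_psi.
case: ltP => [ab|ba]; last first.
  rewrite set_itv_ge ?integral_set0//= bnd_simp -leNgt.
  by rewrite phi_psi psiK.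
have pab : psi a <= psi b by rewrite phi_psi psiK ltW.
rewrite integral_itv_obnd_cbnd; last exact/measurable_EFinP/measurable_funTS.
by rewrite (integral_FTC pab cw dphi) !psiK.
Qed.

Lemma ge0_integral_substitution (G : R -> \bar R) :
  measurable_fun [set: R] G -> (forall x, 0 <= G x)%E ->
  (\int[mu]_x G x = \int[mu]_x ((w x)%:E * G (phi x)))%E.
Proof.
move=> mG G0.
exact: (@ge0_integral_density _ _ _ _ _ mu mu phi w mphi mw w0 nuE).
Qed.

End ge0_substitution.

Section affine.
Context {R : realType}.
Local Notation mu := (@lebesgue_measure R).

Lemma ge0_integral_affine (a b : R) (G : R -> \bar R) : 0 < a ->
  measurable_fun [set: R] G -> (forall x, 0 <= G x)%E ->
  (\int[mu]_x G x = \int[mu]_x (a%:E * G (a * x + b)%R))%E.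
Proof.
move=> a0 mG G0.
apply: (@ge0_integral_substitution R (fun x => a * x + b) (fun y => (y - b) / a)
  (fun=> a)) => //.
- move=> x; apply: is_derive_eq.
  rewrite /GRing.scale/=; ring.
- exact: cst_continuous.
- by move=> _; exact: ltW.
- by move=> x y; rewrite ler_pdivlMr// lerBrDr mulrC.
- by move=> y; rewrite mulrC divfK ?gt_eqF// subrK.
Qed.

Lemma is_derive_mulr_norm (x : R) :
  is_derive x (1 : R) (fun x => x * `|x|) (2 * `|x|).
Proof.
have [x0|x0|->] := ltgtP x 0.
- apply: (@near_eq_is_derive R R^o R^o (fun x : R => - (x * x))).
    near=> y; rewrite ltr0_norm ?mulrN//.
    by near: y; exact: lt_nbhsl.
  by apply: is_derive_eq; rewrite /GRing.scale/= ltr0_norm//; ring.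
- apply: (@near_eq_is_derive R R^o R^o (fun x : R => x * x)).
    near=> y; rewrite gtr0_norm//.
    by near: y; exact: lt_nbhsr.
  by apply: is_derive_eq; rewrite /GRing.scale/= gtr0_norm//; ring.
have H : (fun h : R => h^-1 *: ((h *: (1 : R) + 0 : R) * `|h *: (1 : R) + 0 : R| - 0 * `|0 : R|))
    @ (0 : R)^' --> (2 * `|0 : R| : R).
  have : (fun h : R => `|h| : R) @ (0 : R)^' --> (2 * `|0 : R| : R).
    rewrite (_ : 2 * `|0 : R| = `|0 : R|); last by rewrite normr0 mulr0.
    by apply: cvg_within_filter; exact: norm_continuous.
  apply: cvg_trans; apply: near_eq_cvg; near=> h.
  rewrite /GRing.scale/= mulr1 addr0 normr0 mulr0 subr0 mulKf//.
  by near: h; exact: nbhs_dnbhs_neq.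
apply: DeriveDef; first by apply/cvg_ex; exists (2 * `|0 : R|).
exact: cvg_lim H.
Unshelve. all: by end_near. Qed.

Lemma ltr_mulr_norm (x y : R) : x < y -> x * `|x| < y * `|y|.
Proof.
move=> xy; have [x0|x0] := ltP x 0; have [y0|y0] := ltP y 0.
- by rewrite !ltr0_norm//; nra.
- by rewrite ltr0_norm// ger0_norm//; nra.
- by nra.
- by rewrite !ger0_norm//; nra.
Qed.

(** The map [c x |x|] is an increasing bijection of the line, so this substitution treats both
    half-lines at once; its absolute value is [c x^2] and its derivative is [2 c |x|]. *)
Lemma ge0_integral_normr_sqr (c : R) (G : R -> \bar R) : 0 < c ->
  measurable_fun [set: R] G -> (forall x, 0 <= G x)%E ->
  (\int[mu]_x G `|x|%R =
   \int[mu]_x ((2 * c * `|x|)%:E * G (x ^+ 2 * c)%R))%E.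
Proof.
move=> c0 mG G0.
pose psi (y : R) := Num.sg y * Num.sqrt (`|y| / c).
have psiE y : psi y * `|psi y| * c = y.
  rewrite /psi normrM (ger0_norm (sqrtr_ge0 _)) mulrACA -expr2 sqr_sqrtr; last first.
    by rewrite divr_ge0// ltW.
  have [->|y0] := eqVneq y 0; first by rewrite sgr0 !mul0r.
  rewrite normr_sg y0 mulr1 mulrA divfK ?gt_eqF//.
  by rewrite -numEsg.
rewrite (@ge0_integral_substitution R (fun x => c * (x * `|x|)) psi
  (fun x => c * (2 * `|x|)) _ _ _ _ _ (fun x => G `|x|)) //.
- apply: eq_integral => x _; rewrite [c * (2 * _)]mulrCA mulrA; congr (_ * G _)%E.
  by rewrite normrM (gtr0_norm c0) normrM normr_id -expr2 real_normK ?num_real// mulrC.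
- move=> x; have h := is_derive_mulr_norm x; exact: is_deriveZ.
- move=> x; apply: cvgM; first exact: cvg_cst.
  by apply: cvgM; [exact: cvg_cst|exact: norm_continuous].
- by move=> x; rewrite mulr_ge0 ?mulr_ge0// ltW.
- move=> x y; rewrite -[in RHS](psiE y) [in RHS]mulrC ler_pM2r//.
  by apply/esym/(le_mono (f := fun x : R => x * `|x|)) => ? ?; exact: ltr_mulr_norm.
- by move=> y /=; rewrite mulrC psiE.
- exact: measurableT_comp.
Qed.

End affine.

Ltac meas := repeat lazymatch goal with
  | |- measurable_fun _ (fun=> ?c) => exact: measurable_cst
  | |- measurable_fun _ (fun x => x) => exact: measurable_id
  | |- measurable_fun _ (fun x => (@?f x)%:E) => apply/measurable_EFinP
  | |- measurable_fun _ (EFin \o ?f) => apply/measurable_EFinP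
  | |- measurable_fun _ (fun x => (@?f x * @?g x)%E) => apply: emeasurable_funM
  | |- measurable_fun _ (fun x => (@?f x + @?g x)%E) => apply: emeasurable_funD
  | |- measurable_fun _ (fun x => @?f x + @?g x) => apply: measurable_funD
  | |- measurable_fun _ (fun x => @?f x * @?g x) => apply: measurable_funM
  | |- measurable_fun _ (fun x => - @?f x) =>
      apply: measurableT_comp; [exact: oppr_measurable|]
  | |- measurable_fun _ (fun x => @?f x ^+ ?n) => apply: measurable_funX
  | |- measurable_fun _ (fun x => expR (@?f x)) =>
      apply: measurableT_comp; [exact: measurable_expR|]
  | |- measurable_fun _ (fun x => `| @?f x |) =>
      apply: measurableT_comp; [exact: normr_measurable|]
  | |- measurable_fun _ (fun x => @?f x <= @?g x) => apply: measurable_fun_ler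
  | |- measurable_fun _ (fun x => @?f x < @?g x) => apply: measurable_fun_ltr
  | |- measurable_fun _ (@Order.le _ _ ?c) =>
      apply: (@measurable_fun_ler _ _ _ _ (fun=> c) (fun x => x))
  | |- measurable_fun _ (@Order.lt _ _ ?c) =>
      apply: (@measurable_fun_ltr _ _ _ _ (fun=> c) (fun x => x))
  | |- measurable_fun _ (fun x => Num.max (@?f x) (@?g x)) => apply: measurable_maxr
  | _ => first [assumption | exact: measurable_fst | exact: measurable_snd
               | exact: measurable_id | done
               | apply: measurable_fun_ifT]
  end.

Section integralT.
Context {R : realType}.
Local Notation mu := (@lebesgue_measure R).

Lemma ge0_integralTZl (k : \bar R) (f : R -> \bar R) :
  measurable_fun [set: R] f -> (forall x, 0 <= f x)%E -> (0 <= k)%E ->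
  (\int[mu]_x (k * f x) = k * \int[mu]_x f x)%E.
Proof. by move=> mf f0 k0; apply: ge0_integralZl. Qed.

Lemma ge0_integralTD (f g : R -> \bar R) :
  measurable_fun [set: R] f -> (forall x, 0 <= f x)%E ->
  measurable_fun [set: R] g -> (forall x, 0 <= g x)%E ->
  (\int[mu]_x (f x + g x) = \int[mu]_x f x + \int[mu]_x g x)%E.
Proof. by move=> mf f0 mg g0; apply: ge0_integralD. Qed.

Lemma fubini_tonelliT (K : R -> R -> \bar R) :
  measurable_fun setT (fun z : R * R => K z.1 z.2) -> (forall x y, 0 <= K x y)%E ->
  (\int[mu]_x \int[mu]_y K x y = \int[mu]_y \int[mu]_x K x y)%E.
Proof.
move=> mK K0.
exact: (@fubini_tonelli _ _ (measurableTypeR R) (measurableTypeR R) R mu mu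
  (fun z => K z.1 z.2) mK (fun z => K0 _ _)).
Qed.

Lemma measurable_integralT d (T : measurableType d) (K : T -> R -> \bar R) :
  measurable_fun setT (fun z : T * R => K z.1 z.2) -> (forall x y, 0 <= K x y)%E ->
  measurable_fun setT (fun x => \int[mu]_y K x y)%E.
Proof.
move=> mK K0.
exact: (@measurable_fun_fubini_tonelli_F _ _ T (measurableTypeR R) R mu
  (fun z => K z.1 z.2) mK (fun z => K0 _ _)).
Qed.

End integralT.

(** * Polar coordinates in the plane *)

Section polar.
Context {R : realType}.
Local Notation mu := (@lebesgue_measure R).

Lemma integralT_halfline (G : R -> \bar R) :
  (\int[mu]_(x in `[0%R, +oo[) G x = \int[mu]_x (if (0 <= x)%R then G x else 0))%E.
Proof.
rewrite integral_mkcond; apply: eq_integral => x _; rewrite patchE.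
by have -> : (x \in `[0, +oo[%classic) = (0 <= x)
  by apply/idP/idP; rewrite inE/= in_itv/= andbT.
Qed.

Lemma integralT_itv (a b : R) (G : R -> \bar R) :
  (\int[mu]_(x in `[a, b]) G x =
   \int[mu]_x (if (a <= x)%R then if (x <= b)%R then G x else 0 else 0))%E.
Proof.
rewrite integral_mkcond; apply: eq_integral => x _; rewrite patchE.
have -> : (x \in `[a, b]%classic) = (a <= x) && (x <= b)
  by apply/idP/idP; rewrite inE/= in_itv.
by case: (a <= x).
Qed.

Lemma ge0_integral_even (G : R -> \bar R) :
  measurable_fun [set: R] G -> (forall x, 0 <= G x)%E ->
  (\int[mu]_x G `|x|%R = 2%:E * \int[mu]_x (if (0 <= x)%R then G x else 0))%E.
Proof.
move=> mG G0; rewrite -integralT_halfline.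
have mGn : measurable_fun setT (fun x : R => G `|x|%R) by apply: (measurableT_comp mG); meas.
have -> : [set: R] = `]-oo, 0[ `|` `[0, +oo[.
  by apply/seteqP; split => // x _; rewrite /= !in_itv/= andbT; case: ltP; [left|right].
rewrite ge0_integral_setU//; last 2 first.
- exact: measurable_funTS.
- rewrite disj_set2E; apply/eqP/seteqP; split => // x [] /=.
  by rewrite !in_itv/= andbT => x0; rewrite leNgt x0.
rewrite integral_itv_bndo_bndc; last exact: measurable_funTS.
rewrite (ge0_integration_by_substitution0 mG G0) (_ : 2%:E = (1 + 1)%:E)// EFinD ge0_muleDl ?lee_fin// !mul1e.
congr (_ + _)%E; first by apply: eq_integral => x; rewrite inE/= in_itv/= => x0; rewrite ler0_norm.
rewrite -(ge0_integration_by_substitution0 mG G0).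
by apply: eq_integral => x; rewrite inE/= in_itv/= andbT => x0; rewrite ger0_norm.
Qed.

Lemma measurable_oneDsqrV :
  measurable_fun [set: R] (fun x : R => ((oneDsqr x)^-1)%:E).
Proof.
apply/measurable_EFinP; apply: continuous_measurable_fun.
apply: continuous_oneDsqrV.
Qed.

Lemma integralT_oneDsqr : (\int[mu]_x ((oneDsqr x)^-1)%:E = pi%:E)%E.
Proof.
transitivity (\int[mu]_x ((oneDsqr `|x : R|)^-1)%:E)%E.
  by apply: eq_integral => x _; rewrite /oneDsqr real_normK ?num_real.
rewrite (@ge0_integral_even (fun x => ((oneDsqr x)^-1)%:E)).
- by rewrite -integralT_halfline integral0y_oneDsqr -EFinM mulrC divfK.
- exact: measurable_oneDsqrV.
- by move=> x; rewrite lee_fin invr_ge0 (le_trans ler01)// oneDsqr_ge1.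
Qed.

(* Polar coordinates through the slope [u]: put [y = |x| u] for fixed [x],
   exchange the integrals, then put [t = x^2 (1 + u^2)] for fixed [u]. *)
Lemma ge0_integral_sqnorm (G : R -> \bar R) :
  measurable_fun [set: R] G -> (forall x, 0 <= G x)%E ->
  (\int[mu]_x \int[mu]_y G (x ^+ 2 + y ^+ 2)%R =
   pi%:E * \int[mu]_t (if (0 <= t)%R then G t else 0))%E.
Proof.
move=> mG G0.
pose K (x u : R) := (`|x|%:E * G (x ^+ 2 * oneDsqr u)%R)%E.
have K0 x u : (0 <= K x u)%E by rewrite mule_ge0// lee_fin.
have mK : measurable_fun setT (fun z : R * R => K z.1 z.2).
  rewrite /K /oneDsqr; apply: emeasurable_funM; first by meas.
  by apply: (measurableT_comp mG); meas.
pose S (x y : R) := G (x ^+ 2 + y ^+ 2)%R.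
have mS : measurable_fun setT (fun z : R * R => S z.1 z.2).
  by apply: (measurableT_comp mG); meas.
have mF := measurable_integralT mS (fun x y => G0 (x ^+ 2 + y ^+ 2)%R).
have mFK := measurable_integralT mK K0.
have step1 : (\int[mu]_x \int[mu]_y G (x ^+ 2 + y ^+ 2)%R =
              \int[mu]_x \int[mu]_y K x y)%E.
  rewrite -/S.
  (* The substitution [y = |x| u] degenerates at [x = 0], a null set that is removed from both outer
     integrals. *)
  have m0 : measurable ([set: R] `\ 0) by exact: measurableD.
  rewrite -(integral_setD1 m0 (measurable_funTS mF)).
  rewrite -(integral_setD1 m0 (measurable_funTS mFK)).
  apply: eq_integral => x; rewrite inE/= => -[_ /eqP x0].
  have ax : 0 < `|x| by rewrite normr_gt0.
  rewrite (@ge0_integral_affine _ `|x| 0 (fun y => G (x ^+ 2 + y ^+ 2))%R ax)//.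
  - apply: eq_integral => y _; rewrite /K/= addr0 exprMn real_normK ?num_real//.
    by rewrite /oneDsqr mulrDr mulr1.
  - by apply: (measurableT_comp mG); meas.
rewrite step1 (fubini_tonelliT mK K0) -(muleC _ pi%:E) -integralT_oneDsqr.
set C := (\int[mu]_t (if (0 <= t)%R then G t else 0))%E.
have C0 : (0 <= C)%E by apply: integral_ge0 => t _; case: ifP.
have q0 x : (0 <= ((oneDsqr x : R)^-1)%:E)%E.
  by rewrite lee_fin invr_ge0 (le_trans ler01)// oneDsqr_ge1.
transitivity (\int[mu]_u (C * ((oneDsqr u)^-1)%:E))%E; last first.
  by rewrite (ge0_integralTZl measurable_oneDsqrV).
apply: eq_integral => u _.
have c0 : 0 < oneDsqr u by rewrite (lt_le_trans ltr01)// oneDsqr_ge1.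
have mKu : measurable_fun [set: R] (fun x => K x u).
  rewrite /K; apply: emeasurable_funM; first by meas.
  by apply: (measurableT_comp mG); meas.
(* The integral of [G |x|] is evaluated in two ways: evenness gives [2 C], and the quadratic
   substitution gives [2 (1 + u^2)] times the integral of [K x u] over [x]. Hence the latter is
   [C / (1 + u^2)], and integrating over [u] produces [pi]. *)
have H := ge0_integral_even mG G0; rewrite -/C (ge0_integral_normr_sqr c0 mG G0) in H.
transitivity ((2 * oneDsqr u)^-1%:E * \int[mu]_x ((2 * oneDsqr u)%:E * K x u))%E.
  rewrite (ge0_integralTZl mKu (fun x => K0 x u)); last by rewrite lee_fin mulr_ge0// ltW.
  by rewrite muleA -EFinM mulVf ?mul1e// gt_eqF// mulr_gt0.
transitivity ((2 * oneDsqr u)^-1%:E * (2%:E * C))%E; last first.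
  by rewrite muleA -EFinM invfM mulrAC mulVf// mul1r muleC.
congr (_ * _)%E; rewrite -H; apply: eq_integral => x _.
by rewrite /K muleA -EFinM.
Qed.

End polar.

(** * Expectations over independent exponential variables *)

Section exp_expect.
Context {R : realType}.
Local Notation mu := (@lebesgue_measure R).
Implicit Types (F G : seq R -> \bar R) (n m : nat).

Definition expw (x : R) : R := if 0 <= x then expR (- x) else 0.

Fixpoint exp_expect n F : \bar R :=
  if n is n'.+1 then
    (\int[mu]_x ((expw x)%:E * exp_expect n' (fun s => F (x :: s))))%E
  else F [::].

(* Measurability of the restriction of [F] to sequences of length [n], tested
   against all measurable families of [n] real functions. *)
Definition measurable_seqfun n F := forall d (T : measurableType d) (a : nat -> T -> R),
  (forall i, measurable_fun setT (a i)) ->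
  measurable_fun setT (fun t => F (mkseq (a ^~ t) n)).

Lemma expw_ge0 x : 0 <= expw x.
Proof. by rewrite /expw; case: ifP => // _; exact: expR_ge0. Qed.

Lemma measurable_expw : measurable_fun [set: R] expw.
Proof. by rewrite /expw; meas. Qed.

Lemma mkseq_cons T (f : nat -> T) n : mkseq f n.+1 = f 0%N :: mkseq (f \o succn) n.
Proof. by rewrite /mkseq /= (iotaDl 1 0) -map_comp. Qed.

Lemma measurable_seqfun_cons n F x :
  measurable_seqfun n.+1 F -> measurable_seqfun n (fun s => F (x :: s)).
Proof.
move=> mF d T a ma.
have := mF d T (fun i => if i is j.+1 then a j else cst x).
under eq_fun do rewrite mkseq_cons.
apply; case=> [|i]; [exact: measurable_cst|exact: ma].
Qed.

Lemma exp_expect_ge0 n F : (forall s, 0 <= F s)%E -> (0 <= exp_expect n F)%E.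
Proof.
elim: n F => [|n IH] F F0 //=; apply: integral_ge0 => x _.
by rewrite mule_ge0 ?lee_fin ?expw_ge0// IH.
Qed.

(** The prefix of parameter-dependent entries makes the induction possible: the variable being
    integrated becomes the next entry of the prefix, over the enlarged parameter space [T * R]. *)
Lemma measurable_exp_expect_cat n m F : measurable_seqfun (m + n) F ->
  (forall s, 0 <= F s)%E ->
  forall d (T : measurableType d) (a : nat -> T -> R),
  (forall i, measurable_fun setT (a i)) ->
  measurable_fun setT (fun t => exp_expect n (fun s => F (mkseq (a ^~ t) m ++ s))).
Proof.
elim: n m F => [|n IH] m F mF F0 d T a ma.
  rewrite /=; under eq_fun do rewrite cats0.
  by rewrite addn0 in mF; exact: mF.
pose a' i (z : T * R) := if (i < m)%N then a i z.1 else z.2.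
have ma' i : measurable_fun setT (a' i).
  rewrite /a'; case: (i < m)%N; last exact: measurable_snd.
  exact: measurableT_comp (ma i) measurable_fst.
apply: (@measurable_integralT R d T
  (fun t x => (expw x)%:E * exp_expect n (fun s => F (mkseq (a ^~ t) m ++ x :: s)))%E).
- apply: emeasurable_funM.
    apply/measurable_EFinP; exact: measurableT_comp measurable_expw measurable_snd.
  have mF' : measurable_seqfun (m.+1 + n) F by rewrite addSn -addnS.
  have := IH m.+1 F mF' F0 _ _ a' ma'.
  congr (measurable_fun _ _); apply/funext => z; congr (exp_expect _ _).
  apply/funext => s; congr F; rewrite mkseqS cat_rcons /a' ltnn; congr (_ ++ _).
  by apply/eq_in_map => i; rewrite mem_iota/= add0n => ->.
- by move=> t x; rewrite mule_ge0 ?lee_fin ?expw_ge0// exp_expect_ge0.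
Qed.

Lemma measurable_exp_expect n F : measurable_seqfun n.+1 F ->
  (forall s, 0 <= F s)%E ->
  measurable_fun [set: R] (fun x => exp_expect n (fun s => F (x :: s))).
Proof.
move=> mF F0.
apply: (@measurable_exp_expect_cat n 1 F mF F0 _ _ (fun=> idfun)).
by move=> _; exact: measurable_id.
Qed.

Lemma measurable_expw_exp_expect n F : measurable_seqfun n.+1 F ->
  (forall s, 0 <= F s)%E ->
  measurable_fun [set: R]
    (fun x => ((expw x)%:E * exp_expect n (fun s => F (x :: s)))%E).
Proof.
move=> mF F0; apply: emeasurable_funM; last exact: measurable_exp_expect.
by apply/measurable_EFinP; exact: measurable_expw.
Qed.

Lemma eq_exp_expect n F G :
  (forall s, size s = n -> all (>= 0) s -> F s = G s) ->
  exp_expect n F = exp_expect n G.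
Proof.
elim: n F G => [|n IH] F G FG /=; first exact: FG.
apply: eq_integral => x _; rewrite /expw; case: ifP => x0; last by rewrite !mul0e.
congr (_ * _)%E; apply: IH => s sn s0; apply: FG => /=; first by rewrite sn.
by rewrite x0.
Qed.

Lemma exp_expectZ n F (k : \bar R) : measurable_seqfun n F ->
  (forall s, 0 <= F s)%E -> (0 <= k)%E ->
  exp_expect n (fun s => k * F s)%E = (k * exp_expect n F)%E.
Proof.
elim: n F => [|n IH] F mF F0 k0 //=.
rewrite -ge0_integralTZl//; last 2 first.
- exact: measurable_expw_exp_expect.
- by move=> x; rewrite mule_ge0 ?lee_fin ?expw_ge0// exp_expect_ge0.
apply: eq_integral => x _; rewrite IH//; last exact: measurable_seqfun_cons.
by rewrite muleCA.
Qed.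

Lemma exp_expectD n F G : measurable_seqfun n F -> measurable_seqfun n G ->
  (forall s, 0 <= F s)%E -> (forall s, 0 <= G s)%E ->
  exp_expect n (fun s => F s + G s)%E = (exp_expect n F + exp_expect n G)%E.
Proof.
elim: n F G => [|n IH] F G mF mG F0 G0 //=.
rewrite -ge0_integralTD; last 4 first.
- exact: measurable_expw_exp_expect.
- by move=> x; rewrite mule_ge0 ?lee_fin ?expw_ge0// exp_expect_ge0.
- exact: measurable_expw_exp_expect.
- by move=> x; rewrite mule_ge0 ?lee_fin ?expw_ge0// exp_expect_ge0.
apply: eq_integral => x _.
rewrite (IH _ _ (measurable_seqfun_cons x mF) (measurable_seqfun_cons x mG))//.
by rewrite ge0_muleDr// exp_expect_ge0.
Qed.

(** The last variable is already the innermost one of the iterated integral, so no exchange of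
    integrals is involved. This is conditioning on the first [n] variables. *)
Lemma exp_expect_rcons n F :
  exp_expect n.+1 F =
  exp_expect n (fun s => \int[mu]_x ((expw x)%:E * F (rcons s x)))%E.
Proof.
elim: n F => [|n IH] F //.
rewrite [LHS]/= [RHS]/=; apply: eq_integral => x _; congr (_ * _)%E.
exact: IH (fun s => F (x :: s)).
Qed.

Lemma integral_expRN (a : R) :
  (\int[mu]_(x in `[a, +oo[) (expR (- x))%:E = (expR (- a))%:E)%E.
Proof.
have dF (x : R) : is_derive x (1 : R) (fun x => - expR (- x)) (expR (- x)).
  by apply: is_derive_eq; rewrite /GRing.scale/=; ring.
have cf : continuous (fun x : R => expR (- x)).
  by move=> x; apply: continuous_comp; [exact: opp_continuous|exact: continuous_expR].
rewrite (@ge0_continuous_FTC2y R (fun x => expR (- x)) (fun x => - expR (- x)) a 0).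
- by rewrite sub0e -EFinN opprK.
- by move=> x _; exact: expR_ge0.
- exact: continuous_subspaceT.
- by rewrite -[X in _ --> X]oppr0; apply: cvgN; exact: cvgr_expR.
- by move=> x _; have [] := dF x.
- exact/cvg_at_right_filter/(is_derive_continuous dF).
- by move=> x _; rewrite derive1E; have [] := dF x.
Qed.

Lemma integral_expw_gt (a : R) : 0 <= a ->
  (\int[mu]_x (if a < x then expw x else 0)%:E = (expR (- a))%:E)%E.
Proof.
move=> a0; rewrite -integral_expRN -integral_itv_obnd_cbnd; last first.
  by apply: measurable_funTS; meas.
rewrite [RHS]integral_mkcond; apply: eq_integral => x _; rewrite patchE.
have -> : (x \in `]a, +oo[%classic) = (a < x).
  by apply/idP/idP; rewrite inE/= in_itv/= andbT.
by case: ifP => // ax; rewrite /expw (le_trans a0 (ltW ax)).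
Qed.

Lemma integral_expw : (\int[mu]_x (expw x)%:E = 1)%E.
Proof.
rewrite -expR0 -[in RHS]oppr0 -integral_expRN integralT_halfline.
by apply: eq_integral => x _; rewrite /expw; case: ifP.
Qed.

Lemma exp_expect_cst n (k : \bar R) : (0 <= k)%E -> exp_expect n (fun=> k) = k.
Proof.
move=> k0; elim: n => //= n ->.
under eq_integral do rewrite muleC.
rewrite ge0_integralTZl ?integral_expw ?mule1//.
- by apply/measurable_EFinP; exact: measurable_expw.
- by move=> x; rewrite lee_fin expw_ge0.
Qed.

Lemma exp_expect_take m n F : (m <= n)%N -> (forall s, 0 <= F s)%E ->
  exp_expect n (F \o take m) = exp_expect m F.
Proof.
elim: n m F => [|n IH] [|m] F //= mn F0.
- exact: (@exp_expect_cst n.+1).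
- apply: eq_integral => x _; congr (_ * _)%E.
  by rewrite -(IH m (fun s => F (x :: s))).
Qed.

Lemma measurable_seqfun_shift n F : measurable_seqfun n.+1 F ->
  measurable_seqfun n.+1 (fun s =>
    if s is y :: s' then F (y :: map (fun x => y + x) s') else 0%E).
Proof.
move=> mF d T a ma.
pose a' i := if i is j.+1 then fun t => a 0%N t + a j.+1 t else a 0%N.
rewrite [X in measurable_fun _ X](_ : _ = (fun t => F (mkseq (a' ^~ t) n.+1))).
  by apply: mF; case=> [|i]; [exact: ma|apply: measurable_funD; exact: ma].
by apply/funext => t; rewrite !mkseq_cons /mkseq -map_comp.
Qed.

Lemma measurable_seqfun_cons_shift n F : measurable_seqfun n.+2 F ->
  measurable_seqfun n.+2 (fun s =>
    if s is x :: y :: s' then F (x :: y :: map (fun z => y + z) s') else 0%E).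
Proof.
move=> mF d T a ma.
pose a' i := if i is j.+2 then fun t => a 1%N t + a j.+2 t else a i.
rewrite [X in measurable_fun _ X](_ : _ = (fun t => F (mkseq (a' ^~ t) n.+2))).
  by apply: mF; case=> [|[|i]]; rewrite /a' ?ma//; apply: measurable_funD; exact: ma.
by apply/funext => t; rewrite !mkseq_cons /mkseq -map_comp.
Qed.

(** Variables are converted one at a time. The Gaussian density depends on [x^2 + y^2] only, so
    polar coordinates leave [pi] times a half-line integral; [pi] cancels against the density and
    the scaling [t -> L t] turns rate [L] into rate 1. *)
Lemma cn_expectE (L n : nat) F : (0 < L)%N -> measurable_seqfun n F ->
  (forall s, 0 <= F s)%E ->
  cn_expect L n (fun g => F [seq L%:R * sqnorm z | z <- g]) = exp_expect n F.
Proof.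
move=> L0; elim: n F => [|n IH] F mF F0 //=.
have LR0 : 0 < L%:R :> R by rewrite ltr0n.
pose H x := exp_expect n (fun s => F (x :: s)).
have H0 x : (0 <= H x)%E by exact: exp_expect_ge0.
have mH : measurable_fun [set: R] H by exact: measurable_exp_expect.
pose G (t : R) := ((L%:R / pi * expR (- (L%:R * t)))%:E * H (L%:R * t)%R)%E.
have p0 : 0 < L%:R / pi :> R by rewrite divr_gt0// pi_gt0.
have G0 t : (0 <= G t)%E by rewrite mule_ge0// lee_fin mulr_ge0 ?expR_ge0// ltW.
have mHL : measurable_fun [set: R] (fun t => H (L%:R * t)%R).
  by apply: (measurableT_comp mH); meas.
have mG : measurable_fun [set: R] G.
  by apply: emeasurable_funM => //; meas.
transitivity (\int[mu]_x \int[mu]_y G (x ^+ 2 + y ^+ 2)%R)%E.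
  apply: eq_integral => x _; apply: eq_integral => y _.
  rewrite /G /cn_pdf; congr (_ * _)%E.
  exact: (IH (fun s => F (L%:R * sqnorm (x, y) :: s)) (measurable_seqfun_cons _ mF)).
rewrite ge0_integral_sqnorm//.
have mwH : measurable_fun [set: R] (fun x => (expw x)%:E * H x)%E.
  exact: measurable_expw_exp_expect.
rewrite (@ge0_integral_affine _ L%:R 0 _ LR0 mwH); last first.
  by move=> x; rewrite mule_ge0// lee_fin expw_ge0.
rewrite -ge0_integralTZl//.
- apply: eq_integral => t _; rewrite /G /expw addr0 pmulr_rge0//.
  case: ifP => _; last by rewrite !mul0e !mule0.
  rewrite !muleA -!EFinM; congr (_%:E * _)%E.
  by rewrite mulrA mulrCA divff ?mulr1// gt_eqF// pi_gt0.
- by apply: measurable_fun_ifT => //; meas.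
- by move=> t; case: ifP.
- by rewrite lee_fin pi_ge0.
Qed.

End exp_expect.

(** * The minimum of independent exponential variables *)

Section exp_expect_min.
Context {R : realType}.
Local Notation mu := (@lebesgue_measure R).
Implicit Types (F : seq R -> \bar R) (n : nat).

Definition symmetric_seqfun F := forall s t : seq R, perm_eq s t -> F s = F t.

(* The density of the minimum of [n] independent standard exponential variables. *)
Definition minw n (y : R) : R := if 0 <= y then n%:R * expR (- (n%:R * y)) else 0.

Lemma minw_ge0 n y : 0 <= minw n y.
Proof. by rewrite /minw; case: ifP => // _; rewrite mulr_ge0// expR_ge0. Qed.

Lemma measurable_minw n : measurable_fun [set: R] (minw n).
Proof. by rewrite /minw; meas. Qed.

Lemma integralT_lt_le (x : R) (f : R -> \bar R) : measurable_fun [set: R] f ->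
  (\int[mu]_y (if (x < y)%R then f y else 0) =
   \int[mu]_y (if (x <= y)%R then f y else 0))%E.
Proof.
move=> mf.
transitivity (\int[mu]_(y in `]x, +oo[) f y)%E.
  rewrite [RHS]integral_mkcond; apply: eq_integral => y _; rewrite patchE.
  by have -> : (y \in `]x, +oo[%classic) = (x < y)
    by apply/idP/idP; rewrite inE/= in_itv/= andbT.
rewrite integral_itv_obnd_cbnd; last exact: measurable_funTS.
rewrite [LHS]integral_mkcond; apply: eq_integral => y _; rewrite patchE.
by have -> : (y \in `[x, +oo[%classic) = (x <= y)
  by apply/idP/idP; rewrite inE/= in_itv/= andbT.
Qed.

Lemma measurable_exp_expect_min n F : measurable_seqfun n.+1 F ->
  (forall s, 0 <= F s)%E ->
  measurable_fun [set: R]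
    (fun y => exp_expect n (fun s => F (y :: map (fun x => y + x) s))).
Proof.
move=> mF F0.
apply: (measurable_exp_expect (measurable_seqfun_shift mF)).
by case=> [//|y s]; exact: F0.
Qed.

(* The minimum of i.i.d. exponential variables is independent of the excesses over
   it, which are again i.i.d. exponential. *)
Lemma exp_expect_min n F : measurable_seqfun n.+1 F -> (forall s, 0 <= F s)%E ->
  symmetric_seqfun F ->
  exp_expect n.+1 F =
  (\int[mu]_y ((minw n.+1 y)%:E *
     exp_expect n (fun s => F (y :: map (fun x => y + x)%R s))))%E.
Proof.
elim: n F => [|n IH] F mF F0 sF.
  by apply: eq_integral => y _; rewrite /expw /minw !mul1r.
pose Psi x y := exp_expect n (fun s => F [:: x, y & map (fun z => y + z) s]).
have Psi0 x y : (0 <= Psi x y)%E by exact: exp_expect_ge0.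
have mPsi : measurable_fun setT (fun z : R * R => Psi z.1 z.2).
  have := measurable_exp_expect_cat (m := 2) (n := n)
    (measurable_seqfun_cons_shift mF).
  move=> /(_ _ _ _ (fun i z => if i is 0%N then z.1 else z.2)); apply.
  - by case=> [//|x [//|y s]]; exact: F0.
  - by case=> [|i]; [exact: measurable_fst|exact: measurable_snd].
pose Q x := exp_expect n.+1 (fun t => F (x :: map (fun z => x + z) t)).
have Q0 x : (0 <= Q x)%E by exact: exp_expect_ge0.
have mQ : measurable_fun [set: R] Q by exact: measurable_exp_expect_min.
pose K x y := ((expw x * minw n.+1 y)%:E * Psi x y)%E.
have K0 x y : (0 <= K x y)%E by rewrite mule_ge0// lee_fin mulr_ge0 ?expw_ge0 ?minw_ge0.
have mK : measurable_fun setT (fun z : R * R => K z.1 z.2).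
  apply: emeasurable_funM => //; apply/measurable_EFinP/measurable_funM.
    exact: measurableT_comp measurable_expw measurable_fst.
  exact: measurableT_comp (measurable_minw _) measurable_snd.
(* Here [y] is the minimum of all variables but the first, [x]. On [KA] it is the overall minimum,
   and the excess [x - y] joins the other excesses by symmetry of [F]; on [KB] the overall minimum
   is [x]. *)
pose KA x y := (if (y <= x)%R then K x y else 0)%E.
pose KB x y := (if (x < y)%R then K x y else 0)%E.
have KA0 x y : (0 <= KA x y)%E by rewrite /KA; case: ifP.
have KB0 x y : (0 <= KB x y)%E by rewrite /KB; case: ifP.
have mKA : measurable_fun setT (fun z : R * R => KA z.1 z.2).
  by apply: measurable_fun_ifT => //; meas.
have mKB : measurable_fun setT (fun z : R * R => KB z.1 z.2).
  by apply: measurable_fun_ifT => //; meas.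
have mKx (L : R -> R -> \bar R) x : measurable_fun setT (fun z : R * R => L z.1 z.2) ->
    measurable_fun [set: R] (L x).
  by move=> mL; apply: (measurableT_comp mL (measurable_pair1 x)).
have mKy (L : R -> R -> \bar R) y : measurable_fun setT (fun z : R * R => L z.1 z.2) ->
    measurable_fun [set: R] (L ^~ y).
  by move=> mL; apply: (measurableT_comp mL (measurable_pair2 y)).
have splitK : exp_expect n.+2 F =
    (\int[mu]_x \int[mu]_y KA x y + \int[mu]_x \int[mu]_y KB x y)%E.
  rewrite -ge0_integralTD; last 4 first.
  - exact: measurable_integralT.
  - by move=> x; exact: integral_ge0.
  - exact: measurable_integralT.
  - by move=> x; exact: integral_ge0.
  rewrite [LHS]/=; apply: eq_integral => x _.
  rewrite -ge0_integralTD; [|exact: mKx|exact: KA0|exact: mKx|exact: KB0].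
  rewrite -[X in (_ * X)%E]/(exp_expect n.+1 (fun s => F (x :: s))).
  rewrite (IH (fun s => F (x :: s))); last 3 first.
  - exact: measurable_seqfun_cons.
  - by [].
  - by move=> s t st; apply: sF; rewrite perm_cons.
  rewrite -ge0_integralTZl; last 3 first.
  - apply: emeasurable_funM; last exact: (mKx Psi).
    by apply/measurable_EFinP; exact: measurable_minw.
  - by move=> y; rewrite mule_ge0 ?lee_fin ?minw_ge0// exp_expect_ge0.
  - by rewrite lee_fin expw_ge0.
  apply: eq_integral => y _; rewrite muleA -EFinM -/(Psi x y) -/(K x y) /KA /KB.
  by case: leP; rewrite ?adde0 ?add0e.
have intA : (\int[mu]_x \int[mu]_y KA x y =
    \int[mu]_y ((minw n.+1 y * expR (- y))%:E * Q y))%E.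
  rewrite fubini_tonelliT//; apply: eq_integral => y _.
  rewrite (@ge0_integral_affine _ 1 y (KA ^~ y))//; last exact: mKy.
  rewrite /Q [exp_expect _ _]/= -ge0_integralTZl; last 3 first.
  - apply: (@measurable_expw_exp_expect R n
      (fun s => F (y :: map (fun z => y + z) s))) => //.
    exact: measurable_seqfun_cons y (measurable_seqfun_shift mF).
  - by move=> x; rewrite mule_ge0 ?lee_fin ?expw_ge0// exp_expect_ge0.
  - by rewrite lee_fin mulr_ge0 ?minw_ge0// expR_ge0.
  apply: eq_integral => x _; rewrite mul1e mul1r /KA lerDr /K /expw /minw.
  case: ifP => x0; last by rewrite mul0e mule0.
  have [y0|y0] := boolP (0 <= y); last by rewrite mulr0 !mul0r !mul0e.
  rewrite addr_ge0// opprD expRD muleA -EFinM.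
  congr (_%:E * _)%E; first by rewrite mulrC [expR (- x) * _]mulrC mulrA.
  apply: eq_exp_expect => s _ _; apply: sF; rewrite [x + y]addrC /=.
  by rewrite -(cat1s (y + x)) -(cat1s y) perm_catCA.
have intB : (\int[mu]_x \int[mu]_y KB x y =
    \int[mu]_x ((expw x * expR (- (n.+1%:R * x)))%:E * Q x))%E.
  apply: eq_integral => x _.
  rewrite /KB integralT_lt_le; last exact: mKx.
  rewrite (@ge0_integral_affine _ 1 x)//; last 2 first.
  - by apply: measurable_fun_ifT => //; [meas|exact: mKx].
  - by move=> y; case: ifP.
  (* The induction hypothesis is used a second time, on the excesses over [x]: their minimum is
     [y - x], which matches the translated variable on the other side. *)
  rewrite /Q (IH (fun t => F (x :: map (fun z => x + z) t))); last 3 first.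
  - exact: measurable_seqfun_cons x (measurable_seqfun_shift mF).
  - by [].
  - by move=> s t st; apply: sF; rewrite perm_cons perm_map.
  rewrite -ge0_integralTZl; last 3 first.
  - apply: emeasurable_funM; first by apply/measurable_EFinP; exact: measurable_minw.
    apply: (@measurable_exp_expect_min n (fun t => F (x :: map (fun z => x + z) t))) => //.
    exact: measurable_seqfun_cons x (measurable_seqfun_shift mF).
  - by move=> y; rewrite mule_ge0 ?lee_fin ?minw_ge0// exp_expect_ge0.
  - by rewrite lee_fin mulr_ge0 ?expw_ge0// expR_ge0.
  apply: eq_integral => y _; rewrite mul1e mul1r lerDr /K /expw /minw.
  case: ifP => y0; last by rewrite mul0e mule0.
  case: ifP => x0; last by rewrite !mul0r !mul0e.
  rewrite addr_ge0// muleA -EFinM mulrDr opprD expRD; congr (_%:E * _)%E.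
    by ring.
  apply: eq_exp_expect => s _ _; rewrite /= [y + x]addrC; congr F; congr [:: _, _ & _].
  by rewrite -map_comp; apply: eq_map => z /=; rewrite addrA.
rewrite splitK intA intB -ge0_integralTD; last 4 first.
- apply: emeasurable_funM => //; apply/measurable_EFinP; apply: measurable_funM; last by meas.
  exact: measurable_minw.
- by move=> x; rewrite mule_ge0// lee_fin mulr_ge0 ?minw_ge0 ?expR_ge0.
- apply: emeasurable_funM => //; apply/measurable_EFinP; apply: measurable_funM; last by meas.
  exact: measurable_expw.
- by move=> x; rewrite mule_ge0// lee_fin mulr_ge0 ?expw_ge0 ?expR_ge0.
apply: eq_integral => x _; rewrite -/(Q x) -ge0_muleDl; last 2 first.
- by rewrite lee_fin mulr_ge0 ?minw_ge0// expR_ge0.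
- by rewrite lee_fin mulr_ge0 ?expw_ge0// expR_ge0.
(* Both regions carry [e^(-(n+2) x)], with weights [n+1] and 1, which add up to the density of the
   minimum of [n+2] variables. *)
rewrite -EFinD; congr (_%:E * _)%E; rewrite /expw /minw; case: ifP => x0; last by rewrite !mul0r addr0.
rewrite -mulrA [expR (- x) * _]mulrC -expRD -[X in _ + X]mul1r -mulrDl natr1.
by rewrite -[n.+2%:R]natr1; congr (_ * expR _); ring.
Qed.

End exp_expect_min.

(** * Sums of largest entries and the stopping probability *)

Section tops.
Context {R : realType}.
Implicit Types (s : seq R) (n N : nat).

(* For nonnegative entries this is [topsum N s]; unlike the definition by sorting,
   it is compatible with [cons]. *)
Fixpoint tops s N {struct s} : R :=
  if s is x :: s' then
    if N is N'.+1 then Num.max (tops s' N) (x + tops s' N') else 0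
  else 0.

Lemma tops0 s : tops s 0 = 0.
Proof. by case: s. Qed.

Lemma tops_ge0 s N : 0 <= tops s N.
Proof. by elim: s N => [|x s IH] [|N] //=; rewrite le_max IH. Qed.

Lemma tops_le_cons x s N : tops s N <= tops (x :: s) N.
Proof. by case: N => [|N] /=; rewrite ?tops0// le_max lexx. Qed.

Lemma tops_rem x s1 s2 N : tops (s1 ++ x :: s2) N = tops (x :: s1 ++ s2) N.
Proof.
elim: s1 N => [|y s1 IH] [|N] //.
rewrite [LHS]/= !IH; case: N => [|N] /=.
  by rewrite !tops0 !addr0 -!maxA; congr Num.max; exact: maxC.
by rewrite !addr_maxr !maxA; congr Num.max; [rewrite -!maxA; congr Num.max; exact: maxC|rewrite addrCA].
Qed.

Lemma tops_perm s t N : perm_eq s t -> tops s N = tops t N.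
Proof.
elim: s t N => [|x s IH] t N; first by rewrite perm_sym => /perm_nilP ->.
move=> st; have xt : x \in t by rewrite -(perm_mem st) mem_head.
case/splitPr: xt st => t1 t2; move=> st.
have {}st : perm_eq s (t1 ++ t2).
  by rewrite -(perm_cons x) (perm_trans st)// -[x :: t2]cat1s perm_catCA.
by rewrite tops_rem; case: N => [|N] //=; rewrite !(IH _ _ st).
Qed.

Lemma tops_mono s N : all (>= 0) s -> tops s N <= tops s N.+1.
Proof.
elim: s N => [|x s IH] [|N] //= /andP[x0 s0]; first by rewrite le_max tops_ge0.
by rewrite ge_max !le_max IH //= lerD2l IH // orbT.
Qed.

Lemma tops_small s N : all (>= 0) s -> (size s <= N)%N -> tops s N = \sum_(x <- s) x.
Proof.
elim: s N => [|x s IH] [|N] //=; rewrite ?big_nil//.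
rewrite ltnS => /andP[x0 s0] sN; rewrite big_cons -(IH N)//; apply/max_idPr.
by rewrite (IH N.+1)// ?(leq_trans sN)// (IH N)// lerDr.
Qed.

Lemma tops_sorted s N : all (>= 0) s -> sorted (fun a b => b <= a) s ->
  tops s N = \sum_(x <- take N s) x.
Proof.
(* Giving up one of the [n.+1] selected entries of [r] costs at most the upper bound [x]. *)
have leS x r : 0 <= x -> all (fun y => y <= x) r ->
    forall n, tops r n.+1 <= x + tops r n.
  move=> x0; elim: r => [|y r IH] //=; first by rewrite addr0.
  move=> /andP[yx rx] n; rewrite ge_max.
  case: n => [|n] /=; first by rewrite addr0 tops0 addr0 yx andbT -[x]addr0 -(tops0 r) IH.
  rewrite addr_maxr !le_max IH//= addrCA lerD2l.
  by rewrite IH// orbT.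
elim: s N => [|x s IH] [|N] //=; rewrite ?big_nil//.
move=> /andP[x0 s0] xs; rewrite big_cons -IH//; last exact: path_sorted xs.
apply/max_idPr/leS => //.
by apply: (order_path_min _ xs) => a b d /= ab bd; exact: le_trans bd ab.
Qed.

Lemma topsumE s N : all (>= 0) s -> topsum N s = tops s N.
Proof.
move=> s0; rewrite /topsum; set s' := sort _ s.
have ps : perm_eq s' s by rewrite perm_sort.
rewrite -(tops_perm N ps) tops_sorted//; first by rewrite (perm_all _ ps).
by apply: sort_sorted => a b /=; exact: le_total.
Qed.

Lemma sum_shift (y : R) s :
  \sum_(x <- map (fun x => y + x) s) x = (size s)%:R * y + \sum_(x <- s) x.
Proof.
elim: s => [|x s IH]; first by rewrite !big_nil mul0r addr0.
by rewrite /= !big_cons IH -natr1; ring.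
Qed.

Lemma all_shift (y : R) s : 0 <= y -> all (>= 0) s -> all (>= 0) (map (fun x => y + x) s).
Proof.
by move=> y0 /allP s0; apply/allP => _ /mapP[x xs ->]; apply: addr_ge0 => //; exact: s0.
Qed.

Lemma tops_shift (y : R) s N : 0 <= y -> all (>= 0) s -> (N <= size s)%N ->
  tops (map (fun x => y + x) s) N = N%:R * y + tops s N.
Proof.
move=> y0; elim: s N => [|x s IH] [|N]; rewrite ?tops0 ?mul0r ?addr0// => xs0.
have /andP[x0 s0] : (0 <= x) && all (>= 0) s by [].
(* If every entry is selected, the branch of the maximum that omits the head has too few entries for
   the induction hypothesis; the full sum is computed instead. *)
rewrite leq_eqVlt => /predU1P[[->]|Ns].
  rewrite !tops_small//; first exact: sum_shift.
    exact: all_shift.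
  by rewrite size_map.
rewrite -[LHS]/(Num.max (tops (map (fun x => y + x) s) N.+1)
  (y + x + tops (map (fun x => y + x) s) N)).
rewrite -[tops (x :: s) N.+1]/(Num.max (tops s N.+1) (x + tops s N)).
have Ns' : (N < size s)%N by exact: Ns.
by rewrite !IH ?Ns' ?(ltnW Ns')// addr_maxr -natr1; congr Num.max; ring.
Qed.

(** The head is [y] plus an excess of 0, and a zero entry does not change [tops s N]. It does count
    as an entry, which is why [N] may reach [(size s).+1]. *)
Lemma tops_cons_shift (y : R) s N : 0 <= y -> all (>= 0) s -> (N <= (size s).+1)%N ->
  tops (y :: map (fun x => y + x) s) N = N%:R * y + tops s N.
Proof.
move=> y0 s0; case: N => [|N]; first by rewrite !tops0 mul0r addr0.
rewrite leq_eqVlt => /predU1P[[->]|Ns].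
  rewrite !tops_small//; last 2 first.
  - by rewrite /= y0; exact: all_shift.
  - by rewrite /= size_map.
  by rewrite big_cons sum_shift -natr1; ring.
rewrite -[LHS]/(Num.max (tops (map (fun x => y + x) s) N.+1)
  (y + tops (map (fun x => y + x) s) N)).
have Ns' : (N < size s)%N by exact: Ns.
rewrite !tops_shift ?Ns' ?(ltnW Ns')// -natr1.
rewrite (_ : y + (N%:R * y + tops s N) = (N%:R + 1) * y + tops s N); last by ring.
by apply/max_idPl; rewrite lerD2l tops_mono.
Qed.

Lemma measurable_tops n N d (T : measurableType d) (a : nat -> T -> R) :
  (forall i, measurable_fun setT (a i)) ->
  measurable_fun setT (fun t => tops (mkseq (a ^~ t) n) N).
Proof.
elim: n N a => [|n IH] [|N] a ma.
- exact: measurable_cst.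
- exact: measurable_cst.
- by under eq_fun do rewrite tops0; exact: measurable_cst.
- under eq_fun do rewrite mkseq_cons /=.
  have ma' i : measurable_fun setT ((a \o succn) i) by exact: ma.
  apply: measurable_maxr; first exact: (IH _ (a \o succn)).
  by apply: measurable_funD => //; exact: (IH _ (a \o succn)).
Qed.

End tops.

(** * The stopping probability and its recursion *)

Section stop_prob.
Context {R : realType}.
Local Notation mu := (@lebesgue_measure R).
Implicit Types (s : seq R) (n N M j : nat) (c : R).

(* The conditional probability that a further exponential variable makes the sum of
   the [M.+1] largest exceed [c], on the event that those of [s] do not. *)
Definition stopf M c s : R :=
  if tops s M.+1 <= c then expR (- (c - tops s M)) else 0.

Definition stop_prob M j c := exp_expect j (fun s => (stopf M c s)%:E).

Lemma stopf_ge0 M c s : 0 <= stopf M c s.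
Proof. by rewrite /stopf; case: ifP => // _; exact: expR_ge0. Qed.

Lemma measurable_stopf M c n : measurable_seqfun n (fun s => (stopf M c s)%:E).
Proof.
move=> d T a ma; rewrite /stopf.
have mt N := measurable_tops n N ma.
apply/measurable_EFinP; apply: measurable_fun_ifT; last exact: measurable_cst.
  by apply: measurable_fun_ler; [exact: mt|exact: measurable_cst].
apply: measurableT_comp; first exact: measurable_expR.
apply: measurableT_comp; first exact: oppr_measurable.
apply: measurable_funD; first exact: measurable_cst.
apply: measurableT_comp; first exact: oppr_measurable.
exact: mt.
Qed.

(** Given that the first [j] variables [s] have not crossed, a new variable [x] crosses exactly when
    [x + tops s M > c]. Since [tops s M <= tops s M.+1 <= c], the exponential tail at [c - tops s M]
    is the value in [stopf]. *)
Lemma exp_expect_stop M j c :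
  exp_expect j.+1 (fun s =>
    (((tops (take j s) M.+1 <= c) && (c < tops s M.+1))%:R : R)%:E) = stop_prob M j c.
Proof.
rewrite exp_expect_rcons; apply: eq_exp_expect => s sj s0; rewrite /stopf.
have [sc|sc] := leP (tops s M.+1) c; last first.
  rewrite integral0_eq// => x _.
  by rewrite -cats1 takel_cat ?sj// take_oversize ?sj// leNgt sc mule0.
rewrite -integral_expw_gt; last first.
  by rewrite subr_ge0 (le_trans _ sc)// tops_mono.
apply: eq_integral => x _.
rewrite -{1}cats1 takel_cat ?sj// take_oversize ?sj// sc /=.
rewrite (@tops_perm _ _ (x :: s)); last by rewrite perm_rcons.
rewrite /= lt_max ltNge sc /= ltrBlDr.
by case: ifP; rewrite ?mule1 ?mule0.
Qed.

Lemma stop_prob_lt0 M j c : c < 0 -> stop_prob M j c = 0%E.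
Proof.
move=> c0; rewrite -[RHS](@exp_expect_cst R j 0%E)//.
apply: eq_exp_expect => s _ _; rewrite /stopf leNgt (lt_le_trans c0)//.
exact: tops_ge0.
Qed.

(** Removing the minimum [y] lowers [tops] by [M.+1 * y] in the condition of [stopf] but only by
    [M * y] in its exponent; the difference is the factor [expR (- y)]. *)
Lemma stop_probS M j c : (M <= j)%N ->
  stop_prob M j.+1 c =
  (\int[mu]_y ((minw j.+1 y * expR (- y))%:E * stop_prob M j (c - M.+1%:R * y)%R))%E.
Proof.
move=> Mj; rewrite /stop_prob exp_expect_min; last 3 first.
- exact: measurable_stopf.
- by move=> s; rewrite lee_fin stopf_ge0.
- by move=> s t st; rewrite /stopf !(tops_perm _ st).
apply: eq_integral => y _; rewrite EFinM -muleA.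
rewrite /minw; case: ifP => y0; last by rewrite !mul0e.
congr (_ * _)%E.
rewrite -exp_expectZ; last 3 first.
- exact: measurable_stopf.
- by move=> s; rewrite lee_fin stopf_ge0.
- by rewrite lee_fin expR_ge0.
apply: eq_exp_expect => s sj s0.
rewrite -EFinM /stopf !tops_cons_shift// ?sj ?ltnS ?(leq_trans Mj)//.
rewrite -lerBrDl; case: ifP => _; last by rewrite mulr0.
rewrite -expRD -natr1; congr (expR _)%:E; ring.
Qed.

Lemma is_derive_subXn (a x : R) n :
  is_derive x (1 : R) (fun x => - ((a - x) ^+ n.+1 / n.+1%:R)) ((a - x) ^+ n).
Proof.
have h1 : is_derive x (1 : R) (fun x : R => a - x) (-1).
  by apply: is_derive_eq; rewrite /GRing.scale/=; ring.
have h2 := is_deriveZ (- n.+1%:R^-1) (is_deriveX n h1).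
rewrite (_ : (fun x => _) = (- n.+1%:R^-1) \*: ((fun x : R => a - x) ^+ n.+1)); last first.
  by apply/funext => y; rewrite /= fctE /GRing.scale/= mulNr mulrC.
apply: is_derive_eq; rewrite /GRing.scale/= mulrN1 mulrNN mulrA mulVf ?mul1r//.
Qed.

Lemma integral_subXn (a b : R) n : 0 <= b ->
  (\int[mu]_(x in `[0%R, b]) ((a - x) ^+ n)%:E =
   ((a ^+ n.+1 - (a - b) ^+ n.+1) / n.+1%:R)%:E)%E.
Proof.
move=> b0; rewrite (integral_FTC b0 _ (fun x => is_derive_subXn a x n)); last first.
  move=> x; apply: (@continuous_comp _ _ _ (fun x : R => a - x) (fun y => y ^+ n)).
    by apply: continuousB; [exact: cst_continuous|exact: cvg_id].
  exact: exprn_continuous.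
by rewrite subr0 opprK addrC -mulrBl.
Qed.

(** The exponential density of [s] times [e^-(c - sum s)] is the constant [e^-c] on the simplex of
    nonnegative [s] with sum at most [c], whose volume is [c^j / j!]. *)
Lemma exp_expect_simplex j c :
  exp_expect j (fun s => (if \sum_(x <- s) x <= c
    then expR (- (c - \sum_(x <- s) x)) else 0)%:E) =
  (if 0 <= c then expR (- c) * (c ^+ j / j`!%:R) else 0)%:E.
Proof.
elim: j c => [|j IH] c /=.
  by rewrite big_nil subr0 expr0 divr1 mulr1.
transitivity (\int[mu]_x ((expw x)%:E *
    (if 0 <= c - x then expR (- (c - x)) * ((c - x) ^+ j / j`!%:R) else 0)%:E))%E.
  apply: eq_integral => x _; congr (_ * _)%E; rewrite -IH.
  apply: eq_exp_expect => s _ _; rewrite big_cons lerBrDl opprB opprD.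
  by congr (if _ then expR _ else _)%:E; ring.
case: ifPn => c0; last first.
  rewrite integral0_eq// => x _; rewrite /expw; case: ifP => x0; last by rewrite mul0e.
  rewrite ifF ?mule0//; apply/negbTE; rewrite -ltNge subr_lt0.
  by rewrite (lt_le_trans _ x0)// ltNge.
transitivity ((expR (- c) / j`!%:R)%:E * \int[mu]_(x in `[0%R, c]) ((c - x) ^+ j)%:E)%E; last first.
  rewrite integral_subXn// subrr expr0n/= subr0 -EFinM factS natrM; congr (_%:E).
  by rewrite invfM; ring.
rewrite integralT_itv -ge0_integralTZl.
- apply: eq_integral => x _; rewrite subr_ge0.
  rewrite /expw; case: ifP => x0; last by rewrite mul0e mule0.
  case: ifP => xc /=; last by rewrite !mule0.
  have -> : expR (- c) = expR (- x) * expR (- (c - x)).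
    by rewrite -expRD; congr expR; ring.
  by rewrite -!EFinM; congr (_%:E); ring.
- by meas.
- move=> x; case: ifP => // x0; case: ifP => // xc.
  by rewrite lee_fin exprn_ge0// subr_ge0.
- by rewrite lee_fin divr_ge0 ?expR_ge0.
Qed.

Lemma stop_prob_small M j c : (j <= M)%N -> 0 <= c ->
  stop_prob M j c = (expR (- c) * (c ^+ j / j`!%:R))%:E.
Proof.
move=> jM c0; have := exp_expect_simplex j c; rewrite c0 => <-.
apply: eq_exp_expect => s sj s0.
by rewrite /stopf !tops_small// sj ?(leq_trans jM).
Qed.

End stop_prob.

(** * Closed form of the stopping probability *)

Section stop_prob_closed.
Context {R : realType}.
Local Notation mu := (@lebesgue_measure R).
Implicit Types (M k : nat) (c u v y : R).

(** The coefficient is [(M+1) / M!] at [k = 0], and each step of the recursion multiplies it by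
    [(M+2+k) / (k+1)]: the numerator is the rate of the minimum, the denominator comes from
    integrating a [k]-th power. *)
Definition stop_dens M k c v : R :=
  (M.+1 + k)`!%:R / (k`!%:R * M`!%:R ^+ 2) * expR (- c) *
  (expR (- v) * (1 - expR (- v)) ^+ k * (c - M.+1%:R * v) ^+ M).

Lemma is_derive_expN (x : R) : is_derive x (1 : R) (fun x => expR (- x)) (- expR (- x)).
Proof. by apply: is_derive_eq; rewrite /GRing.scale/=; ring. Qed.

Lemma continuous_expN : continuous (fun x : R => expR (- x)).
Proof. exact: is_derive_continuous is_derive_expN. Qed.

Lemma integral_expN_pow u k : 0 <= u ->
  (\int[mu]_(y in `[0%R, u]) (expR (- y) * (expR (- y) - expR (- u)) ^+ k)%:E =
   ((1 - expR (- u)) ^+ k.+1 / k.+1%:R)%:E)%E.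
Proof.
move=> u0.
pose g y : R := expR (- y) - expR (- u).
have cf : continuous (fun y => expR (- y) * g y ^+ k).
  move=> y; apply: cvgM; first exact: continuous_expN.
  apply: (@continuous_comp _ _ _ g (fun y => y ^+ k)); last exact: exprn_continuous.
  by apply: cvgB; [exact: continuous_expN|exact: cvg_cst].
have dF y : is_derive y (1 : R) (fun y => - (g y ^+ k.+1 / k.+1%:R)) (expR (- y) * g y ^+ k).
  have h1 : is_derive y (1 : R) g (- expR (- y)).
    by rewrite /g; apply: is_derive_eq; rewrite /GRing.scale/=; ring.
  have h2 := is_deriveZ (- k.+1%:R^-1) (is_deriveX k h1).
  rewrite (_ : (fun x => _) = (- k.+1%:R^-1) \*: (g ^+ k.+1)); last first.
    by apply/funext => x; rewrite /= fctE /GRing.scale/= mulNr mulrC.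
  apply: is_derive_eq; rewrite /GRing.scale/= mulrN mulrNN !mulrA mulVf ?mul1r//.
  by rewrite mulrC.
rewrite (integral_FTC u0 cf dF) /g.
by rewrite subrr expr0n/= mul0r oppr0 sub0r opprK expR0.
Qed.

Lemma stop_dens_ge0 M k c v : 0 <= v -> M.+1%:R * v <= c -> 0 <= stop_dens M k c v.
Proof.
move=> v0 vc; rewrite /stop_dens; apply: mulr_ge0.
  by rewrite mulr_ge0 ?expR_ge0// divr_ge0// mulr_ge0// sqr_ge0.
rewrite !mulr_ge0 ?expR_ge0 ?exprn_ge0//; last by rewrite subr_ge0.
by rewrite subr_ge0 -expR0 ler_expR oppr_le0.
Qed.

Lemma stop_dens_meas M k c : measurable_fun [set: R] (stop_dens M k c).
Proof. by rewrite /stop_dens; meas. Qed.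

(* In the induction step, put [u = v + y] and integrate over [y] first: the inner
   integrand is the derivative of [- (e^-y - e^-u)^(k+1)/(k+1)]. *)
Lemma stop_probE M k c : 0 <= c ->
  stop_prob M (M.+1 + k) c =
  (\int[mu]_(v in `[0%R, (c / M.+1%:R)%R]) (stop_dens M k c v)%:E)%E.
Proof.
have N0 : 0 < M.+1%:R :> R by rewrite ltr0n.
have leN y d : (y <= d / M.+1%:R) = (M.+1%:R * y <= d) by rewrite ler_pdivlMr// mulrC.
elim: k c => [|k IH] c c0.
  rewrite addn0 stop_probS// integralT_itv; apply: eq_integral => y _.
  rewrite /minw; case: ifP => y0; last by rewrite mul0r mul0e.
  rewrite leN; case: leP => yc; last by rewrite stop_prob_lt0 ?mule0// subr_lt0.
  rewrite stop_prob_small// ?subr_ge0// -EFinM /stop_dens addn0 expr0 mulr1 fact0 mul1r.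
  have -> : expR (- (c - M.+1%:R * y)) = expR (- c) * expR (M.+1%:R * y).
    by rewrite -expRD; congr expR; ring.
  have e1 : expR (- (M.+1%:R * y)) * expR (M.+1%:R * y) = 1.
    by rewrite -expRD addNr expR0.
  have f0 : M`!%:R != 0 :> R by rewrite pnatr_eq0 -lt0n fact_gt0.
  rewrite factS natrM; congr (_%:E).
  rewrite (_ : _ * _ / _ = M.+1%:R / M`!%:R); last by field.
  transitivity ((expR (- (M.+1%:R * y)) * expR (M.+1%:R * y)) *
    (M.+1%:R / M`!%:R * expR (- c) * (expR (- y) * (c - M.+1%:R * y) ^+ M))).
    by ring.
  by rewrite e1 mul1r.
pose a := c / M.+1%:R.
pose A := (M.+1 + k)`!%:R / (k`!%:R * M`!%:R ^+ 2) * expR (- c) * (M.+1 + k).+1%:R.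
have A0 : 0 <= A by rewrite /A !mulr_ge0 ?expR_ge0// invr_ge0 mulr_ge0// sqr_ge0.
pose K (y u : R) : \bar R :=
  (if (0 <= y)%R then if (y <= u)%R then if (u <= a)%R then
    (A * (expR (- y) * (expR (- y) - expR (- u)) ^+ k) *
      (expR (- u) * (c - M.+1%:R * u) ^+ M))%:E else 0 else 0 else 0)%E.
have K0 y u : (0 <= K y u)%E.
  rewrite /K; do 3 (case: ifP => //?); rewrite lee_fin !mulr_ge0 ?expR_ge0 ?exprn_ge0//.
    by rewrite subr_ge0 ler_expR lerN2.
  by rewrite subr_ge0 -leN.
have mK : measurable_fun setT (fun z : R * R => K z.1 z.2) by rewrite /K; meas.
rewrite addnS stop_probS; last by rewrite addSn ltnW// ltnS leq_addr.
transitivity (\int[mu]_y \int[mu]_u K y u)%E.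
  apply: eq_integral => y _.
  rewrite /minw; case: ifP => y0; last first.
    by rewrite mul0r mul0e integral0_eq// => u _; rewrite /K y0.
  case: (leP (M.+1%:R * y) c) => yc; last first.
    rewrite stop_prob_lt0 ?subr_lt0// mule0 integral0_eq// => u _.
    rewrite /K; case: ifP => // _; case: ifP => // yu; case: ifP => // ua.
    by move: yc; rewrite ltNge -leN (le_trans yu).
  rewrite IH ?subr_ge0// integralT_itv.
  rewrite (@ge0_integral_affine _ 1 (- y)) //; last 2 first.
  - have := stop_dens_meas M k (c - M.+1%:R * y) => mD; meas.
  - move=> v; case: ifP => // v0; case: ifP => // vc.
    by rewrite lee_fin stop_dens_ge0// -leN.
  rewrite -ge0_integralTZl; last 3 first.
  - have := stop_dens_meas M k (c - M.+1%:R * y) => mD; rewrite /stop_dens; meas.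
  - move=> v; rewrite mul1e; case: ifP => // v0; case: ifP => // vc.
    by rewrite lee_fin stop_dens_ge0// -leN.
  - by rewrite lee_fin !mulr_ge0// expR_ge0.
  apply: eq_integral => u _; rewrite mul1e mul1r subr_ge0 /K y0.
  case: ifP => yu; last by rewrite mule0.
  have -> : (u - y <= (c - M.+1%:R * y) / M.+1%:R) = (u <= a).
    by rewrite !leN mulrBr lerBlDr subrK.
  case: ifP => ua; last by rewrite mule0.
  rewrite -EFinM; congr (_%:E).
  rewrite /stop_dens.
  (* In terms of [u] the polynomial factor is free of [y], and [1 - e^-(u-y) = e^y (e^-y - e^-u)].
     All other exponentials in [y] combine to a single [e^-y], the factor that makes the inner
     integrand an exact derivative. *)
  have -> : c - M.+1%:R * y - M.+1%:R * (u - y) = c - M.+1%:R * u by ring.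
  have -> : expR (- (c - M.+1%:R * y)) = expR (- c) * expR (M.+1%:R * y).
    by rewrite -expRD; congr expR; ring.
  have -> : expR (- (u - y)) = expR (- u) * expR y.
    by rewrite -expRD; congr expR; ring.
  have -> : (1 - expR (- u) * expR y) ^+ k = (expR (- y) - expR (- u)) ^+ k * expR (k%:R * y).
    rewrite expRM_natl -exprMn; congr (_ ^+ _).
    by rewrite mulrBl -[expR (- y) * _]expRD addNr expR0.
  have -> : (M.+1 + k).+1%:R * y = M.+1%:R * y + k%:R * y + y.
    by rewrite -natr1 natrD; ring.
  have -> : expR (- (M.+1%:R * y + k%:R * y + y)) =
      expR (- (M.+1%:R * y)) * expR (- (k%:R * y)) * expR (- y).
    by rewrite -!expRD; congr expR; ring.
  have e1 : expR (- (M.+1%:R * y)) * expR (M.+1%:R * y) = 1.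
    by rewrite -expRD addNr expR0.
  have e2 : expR (- (k%:R * y)) * expR (k%:R * y) = 1.
    by rewrite -expRD addNr expR0.
  have e3 : expR (- y) * expR y = 1.
    by rewrite -expRD addNr expR0.
  transitivity ((expR (- (M.+1%:R * y)) * expR (M.+1%:R * y)) *
    (expR (- (k%:R * y)) * expR (k%:R * y)) * (expR (- y) * expR y) *
    (A * (expR (- y) * (expR (- y) - expR (- u)) ^+ k) * (expR (- u) * (c - M.+1%:R * u) ^+ M))).
    by rewrite /A; ring.
  by rewrite e1 e2 e3 !mul1r.
rewrite fubini_tonelliT// integralT_itv; apply: eq_integral => u _.
case: (leP 0 u) => u0; last first.
  rewrite integral0_eq// => y _; rewrite /K; case: ifP => // y0; case: ifP => // yu.
  by move: u0; rewrite ltNge (le_trans y0 yu).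
rewrite -/a; case: ifP => ua; last first.
  by rewrite integral0_eq// => y _; rewrite /K ua; do 2 case: ifP => //.
transitivity ((A * (expR (- u) * (c - M.+1%:R * u) ^+ M))%:E *
  \int[mu]_(y in `[0%R, u]) (expR (- y) * (expR (- y) - expR (- u)) ^+ k)%:E)%E.
  rewrite integralT_itv -ge0_integralTZl.
  - apply: eq_integral => y _; rewrite /K ua.
    case: ifP => y0; last by rewrite mule0.
    case: ifP => yu; last by rewrite mule0.
    by rewrite -EFinM; congr (_%:E); ring.
  - by meas.
  - move=> y; case: ifP => // y0; case: ifP => // yu.
    by rewrite lee_fin mulr_ge0 ?expR_ge0// exprn_ge0// subr_ge0 ler_expR lerN2.
  - rewrite lee_fin !mulr_ge0 ?expR_ge0// exprn_ge0// subr_ge0 -leN.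
    exact: ua.
rewrite integral_expN_pow// -EFinM; congr (_%:E).
rewrite /stop_dens /A addnS !factS !natrM !invfM; ring.
Qed.

End stop_prob_closed.

Section continuity.
Context {R : realType}.
Implicit Types (f g : R -> R) (x : R).

Lemma continuous_at_addr f g x : continuous_at x f -> continuous_at x g ->
  continuous_at x (fun x => f x + g x).
Proof. by move=> cf cg; apply: cvgD; [exact: cf|exact: cg]. Qed.

Lemma continuous_at_mulr f g x : continuous_at x f -> continuous_at x g ->
  continuous_at x (fun x => f x * g x).
Proof. by move=> cf cg; apply: cvgM; [exact: cf|exact: cg]. Qed.

Lemma continuous_at_oppr f x : continuous_at x f -> continuous_at x (fun x => - f x).
Proof. by move=> cf; apply: cvgN; exact: cf. Qed.

Lemma continuous_at_exprn f n x : continuous_at x f -> continuous_at x (fun x => f x ^+ n).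
Proof.
by move=> cf; apply: (@continuous_comp _ _ _ f (fun y => y ^+ n)) => //; exact: exprn_continuous.
Qed.

Lemma continuous_at_expR f x : continuous_at x f -> continuous_at x (fun x => expR (f x)).
Proof. by move=> cf; apply: continuous_comp => //; exact: continuous_expR. Qed.

Lemma continuous_sumr (I : Type) (r : seq I) (F : I -> R -> R) :
  (forall i, continuous (F i)) -> continuous (fun x => \sum_(i <- r) F i x).
Proof.
move=> cF; elim: r => [|i r IH].
  by under eq_fun do rewrite big_nil; exact: cst_continuous.
under eq_fun do rewrite big_cons; move=> x.
by apply: continuous_at_addr; [exact: cF|exact: IH].
Qed.

End continuity.

Ltac cont := move=> ?; repeat lazymatch goal with
  | |- continuous_at _ (fun=> ?c) => exact: cst_continuous
  | |- continuous_at _ (fun x => x) => exact: cvg_id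
  | |- continuous_at _ (fun x => @?f x + @?g x) => apply: continuous_at_addr
  | |- continuous_at _ (fun x => @?f x * @?g x) => apply: continuous_at_mulr
  | |- continuous_at _ (fun x => - @?f x) => apply: continuous_at_oppr
  | |- continuous_at _ (fun x => @?f x ^+ ?n) => apply: continuous_at_exprn
  | |- continuous_at _ (fun x => expR (@?f x)) => apply: continuous_at_expR
  | H : forall x, continuous_at x ?f |- continuous_at _ ?f => exact: H
  | _ => first [exact: cvg_id | exact: exprn_continuous | exact: opp_continuous
               | exact: continuous_expR | exact: mulrl_continuous | done]
  end.

(** * Real integrals of continuous functions over a segment *)

Section rint.
Context {R : realType}.
Local Notation mu := (@lebesgue_measure R).
Implicit Types (f g : R -> R) (a : R).

(** The binomial expansions have alternating signs, so the calculus of nonnegative integrands no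
    longer applies. On a segment, continuity alone gives finiteness and linearity. *)
Definition rint a f : R := fine (\int[mu]_(x in `[0%R, a]) (f x)%:E)%E.

Lemma continuous_integrable_itv a f : continuous f -> mu.-integrable `[0, a] (EFin \o f).
Proof.
move=> cf; apply: continuous_compact_integrable; first exact: segment_compact.
exact: continuous_subspaceT.
Qed.

Lemma rintE a f : continuous f -> (\int[mu]_(x in `[0%R, a]) (f x)%:E = (rint a f)%:E)%E.
Proof.
move=> cf; rewrite /rint fineK//; apply: integrable_fin_num => //.
exact: continuous_integrable_itv.
Qed.

Lemma eq_rint a f g : (forall x, f x = g x) -> rint a f = rint a g.
Proof. by move=> /funext ->. Qed.

Lemma rintD a f g : continuous f -> continuous g ->
  rint a (fun x => f x + g x) = rint a f + rint a g.
Proof.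
by move=> cf cg; apply: RintegralD => //; exact: continuous_integrable_itv.
Qed.

Lemma rintZ a k f : continuous f -> rint a (fun x => k * f x) = k * rint a f.
Proof.
by move=> cf; apply: RintegralZl => //; exact: continuous_integrable_itv.
Qed.

Lemma rint_sum a (I : Type) (r : seq I) (w : I -> R) (F : I -> R -> R) :
  (forall i, continuous (F i)) ->
  \sum_(i <- r) w i * rint a (F i) = rint a (fun x => \sum_(i <- r) w i * F i x).
Proof.
move=> cF; elim: r => [|i r IH].
  rewrite big_nil (@eq_rint a _ (fun=> 0 * 0)); last by move=> x; rewrite big_nil mul0r.
  by rewrite rintZ ?mul0r//; exact: cst_continuous.
rewrite big_cons IH -rintZ// -rintD.
- by apply: eq_rint => x; rewrite big_cons.
- by have := cF i => cFi; cont.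
- by apply: continuous_sumr => j; have := cF j => cFj; cont.
Qed.

Lemma rint_scale a b f : 0 < b -> continuous f ->
  (forall x, 0 <= x -> x <= b * a -> 0 <= f x) ->
  rint a (fun x => f (b * x)) = b^-1 * rint (b * a) f.
Proof.
move=> b0 cf f0.
have mf : measurable_fun [set: R] f by exact: continuous_measurable_fun.
rewrite /rint.
have -> : (\int[mu]_(x in `[0%R, (b * a)%R]) (f x)%:E =
    b%:E * \int[mu]_(x in `[0%R, a]) (f (b * x))%:E)%E.
  rewrite !integralT_itv (@ge0_integral_affine _ b 0)//; last 2 first.
  - by meas.
  - by move=> x; case: ifP => // x0; case: ifP => // xb; rewrite lee_fin f0.
  have mfb : measurable_fun [set: R] (fun x => f (b * x)).
    by apply: (measurableT_comp mf); meas.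
  rewrite -ge0_integralTZl; last 3 first.
  - by meas.
  - move=> x; case: ifP => // x0; case: ifP => // xa; rewrite lee_fin f0//.
      by rewrite mulr_ge0// ltW.
    by rewrite ler_pM2l.
  - by rewrite lee_fin ltW.
  by apply: eq_integral => x _; rewrite addr0 pmulr_rge0// ler_pM2l.
have cfb : continuous (fun x => f (b * x)).
  move=> x; apply: (@continuous_comp _ _ _ (fun x => b * x) f); last exact: cf.
  exact: mulrl_continuous.
by rewrite rintE// -EFinM /= mulKf// gt_eqF.
Qed.

End rint.

(** * Incomplete gamma functions *)

Section gamma.
Context {R : realType}.
Local Notation mu := (@lebesgue_measure R).
Implicit Types (a x t : R) (n s : nat).

Definition gamma_dens n t : R := t ^+ n * expR (- t).

Lemma continuous_gamma_dens n : continuous (gamma_dens n).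
Proof. by rewrite /gamma_dens; cont. Qed.

Lemma measurable_gamma_dens n : measurable_fun [set: R] (gamma_dens n).
Proof. by apply: continuous_measurable_fun; exact: continuous_gamma_dens. Qed.

Lemma lower_inc_gammaE s a : lower_inc_gamma s a = rint a (gamma_dens s.-1).
Proof.
rewrite /lower_inc_gamma /rint; by congr (fine (integral _ _ _)).
Qed.

Lemma expn_le_fact_expR n x : 0 <= x -> x ^+ n <= n`!%:R * expR x.
Proof.
case: n => [|n] x0; first by rewrite expr0 fact0 mul1r -expR0 ler_expR.
rewrite mulrC -ler_pdivrMr ?ltr0n ?fact_gt0//.
by apply: le_trans (expR_ge1Dxn n x0); rewrite lerDr.
Qed.

(** [upper_inc_gamma] is defined through [fine], so its values can be subtracted only once the
    integral is known to be finite. With [y = t/2], the bound [y^n <= n! e^y] gives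
    [t^n e^-t <= n! 2^n e^(-t/2)]. *)
Lemma integral_gamma_dens_lty n :
  (\int[mu]_(t in `[0%R, +oo[) (gamma_dens n t)%:E < +oo)%E.
Proof.
rewrite integralT_halfline.
apply: (@le_lt_trans _ _ (\int[mu]_t ((n`!%:R * 2 ^+ n)%:E * (expw (2^-1 * t))%:E))%E).
  apply: ge0_le_integral => //.
  - by move=> t _; case: ifP => // t0; rewrite lee_fin mulr_ge0 ?expR_ge0// exprn_ge0.
  - have := measurable_gamma_dens n => mg; meas.
  - apply: emeasurable_funM; first by meas.
    apply/measurable_EFinP; apply: (measurableT_comp measurable_expw); meas.
  - move=> t _; rewrite -EFinM /expw pmulr_rge0//.
    case: ifP => t0; last by rewrite mulr0.
    rewrite lee_fin /gamma_dens; set y := 2^-1 * t.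
    have tE : t = 2 * y by rewrite /y mulVKf.
    have y0 : 0 <= y by rewrite mulr_ge0.
    have e1 : expR y * expR (- y) = 1 by rewrite -expRD subrr expR0.
    have h : y ^+ n * expR (- y) <= n`!%:R.
      have -> : n`!%:R = n`!%:R * expR y * expR (- y) by rewrite -mulrA e1 mulr1.
      rewrite ler_pM2r ?expR_gt0//; exact: (expn_le_fact_expR n y0).
    rewrite tE exprMn (_ : expR (- (2 * y)) = expR (- y) * expR (- y)); last first.
      by rewrite -expRD; congr expR; ring.
    rewrite (_ : _ * _ * _ = 2 ^+ n * expR (- y) * (y ^+ n * expR (- y))); last by ring.
    rewrite (_ : n`!%:R * _ * _ = 2 ^+ n * expR (- y) * n`!%:R); last by ring.
    by rewrite ler_wpM2l// mulr_ge0 ?exprn_ge0 ?expR_ge0.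
have mw : measurable_fun [set: R] (fun x => (expw (2^-1 * x + 0))%:E : \bar R).
  apply/measurable_EFinP; apply: (measurableT_comp measurable_expw); meas.
have i1 : (\int[mu]_x (2^-1%:E * (expw (2^-1 * x + 0))%:E) = 1 :> \bar R)%E.
  rewrite -integral_expw [RHS](@ge0_integral_affine _ 2^-1 0)//.
    by apply/measurable_EFinP; exact: measurable_expw.
  by move=> x; rewrite lee_fin expw_ge0.
rewrite (_ : integral _ _ _ = (n`!%:R * 2 ^+ n * 2)%:E)%E ?ltry//.
rewrite -[RHS]mule1 -i1 -ge0_integralTZl.
- apply: eq_integral => x _; rewrite muleA -!EFinM addr0; congr (_%:E).
  by rewrite mulfK.
- by apply: emeasurable_funM => //; meas.
- by move=> x; rewrite mule_ge0// lee_fin expw_ge0.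
- by rewrite lee_fin !mulr_ge0// exprn_ge0.
Qed.

Lemma upper_inc_gammaB s a : 0 <= a ->
  upper_inc_gamma s 0 - upper_inc_gamma s a = rint a (gamma_dens s.-1).
Proof.
move=> a0.
have uE x : upper_inc_gamma s x = fine (\int[mu]_(t in `[x, +oo[) (gamma_dens s.-1 t)%:E)%E.
  rewrite /upper_inc_gamma; congr (fine (integral _ _ _)).
  by apply/seteqP; split => y /=; rewrite in_itv/= andbT.
have mg D : measurable_fun D (fun t => (gamma_dens s.-1 t)%:E).
  by apply: measurable_funTS; apply/measurable_EFinP; exact: measurable_gamma_dens.
have g0 t : 0 <= t -> (0 <= (gamma_dens s.-1 t)%:E)%E.
  by move=> t0; rewrite lee_fin mulr_ge0 ?expR_ge0// exprn_ge0.
have fin x : 0 <= x -> (\int[mu]_(t in `[x, +oo[) (gamma_dens s.-1 t)%:E)%E \is a fin_num.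
  move=> x0; rewrite ge0_fin_numE; last first.
    by apply: integral_ge0 => t; rewrite /= in_itv/= andbT => xt; apply: g0; exact: le_trans xt.
  apply: le_lt_trans (integral_gamma_dens_lty s.-1).
  apply: ge0_subset_integral => //.
  - exact: mg.
  - by move=> t /=; rewrite in_itv/= andbT; exact: g0.
  - by move=> t /=; rewrite !in_itv/= !andbT; exact: le_trans.
have split0 : (\int[mu]_(t in `[0%R, +oo[) (gamma_dens s.-1 t)%:E =
    \int[mu]_(t in `[0%R, a]) (gamma_dens s.-1 t)%:E +
    \int[mu]_(t in `[a, +oo[) (gamma_dens s.-1 t)%:E)%E.
  rewrite -(integral_itv_obnd_cbnd (r := a)); last exact: mg.
  rewrite -ge0_integral_setU//.
  - by rewrite -itv_bndbnd_setU// bnd_simp.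
  - exact: mg.
  - move=> t /= [|]; rewrite in_itv/= ?andbT; first by case/andP => t0 _; exact: g0.
    by move=> /ltW at_; apply: g0; exact: le_trans at_.
  - rewrite disj_set2E; apply/eqP/seteqP; split => // t [] /=.
    by rewrite !in_itv/= andbT => /andP[_ ta]; rewrite ltNge ta.
rewrite !uE split0 (rintE _ (@continuous_gamma_dens s.-1)) fineD ?fin//=.
by rewrite addrK.
Qed.

(** The power vanishes at 0 and the difference of upper functions is an integral over [[0, a]], so
    the whole bracket is one integral over that segment. When [s2 = s1 + p + 1] and [s1 >= 1], as in
    [Pj1] and [Pj2], its quotient by [p + 1] is the integral over [[0, a]] of [t^p] times the lower
    function of order [s1] at [t]. *)
Lemma inc_gamma_bracket p s1 s2 a : 0 <= a ->
  (a ^+ p.+1 * lower_inc_gamma s1 a + upper_inc_gamma s2 a)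
  - (0 ^+ p.+1 * lower_inc_gamma s1 0 + upper_inc_gamma s2 0) =
  rint a (fun t => (a ^+ p.+1 * t ^+ s1.-1 - t ^+ s2.-1) * expR (- t)).
Proof.
move=> a0; rewrite expr0n/= mul0r add0r -addrA -opprB upper_inc_gammaB// lower_inc_gammaE.
rewrite -rintZ; last exact: continuous_gamma_dens.
rewrite -[X in _ + X]mulN1r -rintZ; last exact: continuous_gamma_dens.
rewrite -rintD; last 2 first.
- by rewrite /gamma_dens; cont.
- by rewrite /gamma_dens; cont.
by apply: eq_rint => t; rewrite /gamma_dens; ring.
Qed.

End gamma.

(** * The formulas for the stopping probability *)

Section binomial_integral.
Context {R : realType}.
Implicit Types (r m n : nat) (x y a t z : R).

(** Both sides are the integral of [(s + y)^r] for [s] from 0 to [x]; algebraically,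
    [C(r,m) / (m+1) = C(r+1,m+1) / (r+1)] reduces the sum to the binomial theorem without its first
    term. *)
Lemma sum_binomial_int r x y :
  \sum_(m < r.+1) 'C(r, m)%:R / m.+1%:R * (x ^+ m.+1 * y ^+ (r - m)) =
  ((x + y) ^+ r.+1 - y ^+ r.+1) / r.+1%:R.
Proof.
rewrite [x + y]addrC exprDn [in RHS]big_ord_recl [in RHS]/= ?subn0 ?expr0 ?bin0 ?mulr1 ?mulr1n.
rewrite addrAC subrr add0r.
rewrite mulr_suml; apply: eq_bigr => m _.
rewrite /bump/= add1n subSS -[_ *+ 'C(r.+1, m.+1)]mulr_natr.
have -> : 'C(r, m)%:R / m.+1%:R = 'C(r.+1, m.+1)%:R / r.+1%:R :> R; last by ring.
apply/eqP; rewrite eqr_div ?pnatr_eq0// -!natrM; apply/eqP; congr (_%:R).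
by rewrite mulnC (mul_bin_diag r.+1 m) mulnC.
Qed.

Lemma sum_binomial_int_rev m x y :
  \sum_(n < m.+1) 'C(m, n)%:R / (m - n).+1%:R * (x ^+ (m - n).+1 * y ^+ n) =
  ((x + y) ^+ m.+1 - y ^+ m.+1) / m.+1%:R.
Proof.
rewrite -sum_binomial_int (reindex_inj rev_ord_inj); apply: eq_bigr => n _ /=.
by rewrite subSS subKn -1?ltnS// bin_sub// -ltnS.
Qed.

Lemma expr_subC r a t : (t - a) ^+ r.+1 = - ((-1) ^+ r * (a - t) ^+ r.+1).
Proof. by rewrite -[t - a]opprB -[- (a - t)]mulN1r exprMn [(-1) ^+ r.+1]exprS -mulrA mulN1r. Qed.

End binomial_integral.

Section stop_prob_formula.
Context {R : realType}.
Implicit Types (r m n k l : nat) (a c t : R).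

(** The integral shared by both formulas. Here [r] stands for [NRF - 2], so that the truncated
    predecessors in the formulas become exact. *)
Definition gamma_conv r a : R := rint a (fun t => expR (- t) * (a - t) ^+ r.+1).

Lemma continuous_gamma_conv r a : continuous (fun t => expR (- t) * (a - t) ^+ r.+1).
Proof. by cont. Qed.

(** Under the integral the sum splits into binomial sums at [(x, y) = (-a, t)] and [(-1, 1)]. Their
    [t^(r+1)] terms cancel, and [(t - a)^(r+1)] remains. *)
Lemma Pj1_inner r a :
  \sum_(m < r.+1) ('C(r, m)%:R * (-1) ^+ m / m.+1%:R) *
    rint a (fun t => (a ^+ m.+1 * t ^+ (r - m) - t ^+ r.+1) * expR (- t)) =
  (-1) ^+ r / r.+1%:R * gamma_conv r a.
Proof.
rewrite rint_sum; last by move=> m; cont.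
rewrite -rintZ; last exact: continuous_gamma_conv.
apply: eq_rint => t.
transitivity ((- (\sum_(m < r.+1) 'C(r, m)%:R / m.+1%:R * ((- a) ^+ m.+1 * t ^+ (r - m)))
  + t ^+ r.+1 * (\sum_(m < r.+1) 'C(r, m)%:R / m.+1%:R * ((-1) ^+ m.+1 * 1 ^+ (r - m))))
  * expR (- t)).
  rewrite mulr_sumr -sumrN -big_split/= mulr_suml; apply: eq_bigr => m _.
  by rewrite expr1n !exprS [(- a) ^+ m]exprNn; ring.
rewrite !sum_binomial_int addNr expr0n/= expr1n.
rewrite [- a + t]addrC (expr_subC r a t).
by ring.
Qed.

(** The sum over [n] leaves a difference of [m+1]-st powers. The factor [1/(r+1)^m] then makes the
    sum over [m] binomial, at [x = -a] and at [x = (t - (r+2) a)/(r+1)]. In both cases [x + t] is a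
    multiple of [t - a], with ratios 1 and [(r+2)/(r+1)], and the [t^(r+1)] terms cancel. *)
Lemma Pj2_inner r a :
  \sum_(m < r.+1) ('C(r, m)%:R / r.+1%:R ^+ m) *
    \sum_(n < m.+1) ('C(m, n)%:R * (- (r.+2%:R * a)) ^+ n / (m - n).+1%:R) *
      rint a (fun t => (a ^+ (m - n).+1 * t ^+ (r - m) - t ^+ (r.+1 - n)) * expR (- t)) =
  (-1) ^+ r * ((r.+2%:R / r.+1%:R) ^+ r.+1 - 1) * gamma_conv r a.
Proof.
have r0 : r.+1%:R != 0 :> R by rewrite pnatr_eq0.
transitivity (\sum_(m < r.+1) ('C(r, m)%:R / r.+1%:R ^+ m) *
  rint a (fun t => (t ^+ (r - m) / m.+1%:R *
    ((- (r.+1%:R * a)) ^+ m.+1 - (t - r.+2%:R * a) ^+ m.+1)) * expR (- t))).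
  apply: eq_bigr => m _; congr (_ * _).
  rewrite rint_sum; last by move=> n; cont.
  apply: eq_rint => t.
  transitivity (t ^+ (r - m) *
    (\sum_(n < m.+1) 'C(m, n)%:R / (m - n).+1%:R * (a ^+ (m - n).+1 * (- (r.+2%:R * a)) ^+ n)
    - \sum_(n < m.+1) 'C(m, n)%:R / (m - n).+1%:R * (t ^+ (m - n).+1 * (- (r.+2%:R * a)) ^+ n))
    * expR (- t)).
    rewrite -sumrB mulr_sumr mulr_suml; apply: eq_bigr => n _.
    have -> : (r.+1 - n = (r - m) + (m - n).+1)%N.
      by have := ltn_ord m; have := ltn_ord n; rewrite !ltnS; lia.
    by rewrite exprD; ring.
  rewrite !sum_binomial_int_rev.
  have -> : a + - (r.+2%:R * a) = - (r.+1%:R * a) by rewrite -natr1; ring.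
  by ring.
rewrite rint_sum; last by move=> m; cont.
rewrite -rintZ; last exact: continuous_gamma_conv.
apply: eq_rint => t.
transitivity (r.+1%:R * (\sum_(m < r.+1) 'C(r, m)%:R / m.+1%:R * ((- a) ^+ m.+1 * t ^+ (r - m))
  - \sum_(m < r.+1) 'C(r, m)%:R / m.+1%:R *
      (((t - r.+2%:R * a) / r.+1%:R) ^+ m.+1 * t ^+ (r - m))) * expR (- t)).
  rewrite -sumrB mulr_sumr mulr_suml; apply: eq_bigr => m _.
  rewrite -mulrN exprMn expr_div_n [r.+1%:R ^+ m.+1]exprS.
  have rm0 : r.+1%:R ^+ m != 0 :> R by rewrite expf_eq0 (negbTE r0) andbF.
  have m0 : m.+1%:R != 0 :> R by rewrite pnatr_eq0.
  move: rm0 m0 r0; move: (r.+1%:R : R) (m.+1%:R : R) => rho mu1 rm0 m0 r0.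
  by field; rewrite r0 m0 rm0.
rewrite !sum_binomial_int.
rewrite [- a + t]addrC (expr_subC r a t).
have -> : ((t - r.+2%:R * a) / r.+1%:R + t) ^+ r.+1 =
    - ((-1) ^+ r * (r.+2%:R / r.+1%:R) ^+ r.+1 * (a - t) ^+ r.+1).
  rewrite (_ : _ + t = r.+2%:R / r.+1%:R * (t - a)); last first.
    by rewrite -[r.+2%:R]natr1; move: (r.+1%:R : R) r0 => rho r0; field.
  by rewrite exprMn (expr_subC r a t) mulrN mulrCA mulrA.
move: ((r.+2%:R / r.+1%:R) ^+ r.+1 : R) => z.
by move: (r.+1%:R : R) r0 => rho r0; field.
Qed.

(** Substituting [t = (l+1) v] turns [c - (M+1) v] into [(M+1)/(l+1)] times [a - t], where
    [a = c (l+1)/(M+1)] is the endpoint at which the gamma brackets are evaluated. *)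
Lemma rint_stop_dens_term M l c : 0 <= c ->
  rint (c / M.+1%:R) (fun v => expR (- (l.+1%:R * v)) * (c - M.+1%:R * v) ^+ M) =
  (M.+1%:R / l.+1%:R) ^+ M / l.+1%:R *
  rint (c * l.+1%:R / M.+1%:R) (fun t => expR (- t) * (c * l.+1%:R / M.+1%:R - t) ^+ M).
Proof.
move=> c0.
have l0 : 0 < l.+1%:R :> R by rewrite ltr0n.
have M0 : 0 < M.+1%:R :> R by rewrite ltr0n.
pose q t : R := expR (- t) * (c * l.+1%:R / M.+1%:R - t) ^+ M.
have cq : continuous q by rewrite /q; cont.
have := @rint_scale R (c / M.+1%:R) l.+1%:R q l0 cq.
rewrite (_ : l.+1%:R * (c / M.+1%:R) = c * l.+1%:R / M.+1%:R); last by ring.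
move=> H; rewrite -mulrA -H; last first.
  by move=> x x0 xc; rewrite mulr_ge0 ?expR_ge0// exprn_ge0// subr_ge0.
rewrite -rintZ; last first.
  by rewrite /q; cont.
apply: eq_rint => v; rewrite /q mulrCA -exprMn; congr (_ * _ ^+ _).
by field; rewrite !gt_eqF.
Qed.

Lemma stop_dens_expand M k c v :
  stop_dens M k c v =
  (M.+1 + k)`!%:R / (k`!%:R * M`!%:R ^+ 2) * expR (- c) *
  \sum_(l < k.+1) ('C(k, l)%:R * (-1) ^+ l) *
     (expR (- (l.+1%:R * v)) * (c - M.+1%:R * v) ^+ M).
Proof.
rewrite /stop_dens; congr (_ * _).
rewrite exprDn [in LHS]mulrAC mulr_sumr; apply: eq_bigr => l _.
rewrite expr1n mul1r -[_ *+ 'C(k, l)]mulr_natr [(- expR (- v)) ^+ l]exprNn -expRM_natl.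
have -> : expR (- (l.+1%:R * v)) = expR (- v) * expR (l%:R * - v).
  by rewrite -expRD -natr1; congr expR; ring.
by ring.
Qed.

Variables (Nt L : nat) (alpha : R).
Hypotheses (Nt0 : (0 < Nt)%N) (L0 : (0 < L)%N) (alpha0 : 0 < alpha).

Local Notation c := (Defs.cst Nt L alpha).

Let c0 : 0 <= c.
Proof. by rewrite /Defs.cst divr_ge0// mulr_ge0// ltW. Qed.

Let aE r l : L%:R * alpha * l.+1%:R / (Nt%:R * r.+2%:R) = c * l.+1%:R / r.+2%:R :> R.
Proof. by rewrite /Defs.cst invfM; ring. Qed.

Lemma Pj1E r k :
  Pj1 Nt L r.+2 alpha (r.+2 + k) =
  \sum_(l < k.+1) ((1 - r.+2%:R) / L%:R) ^+ r.+2 * expR (- c) / (r.+2%:R - 1) *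
    beta R L r.+2 (r.+2 + k) l / l.+1%:R ^+ r.+2 *
    ((-1) ^+ r / r.+1%:R * gamma_conv r (c * l.+1%:R / r.+2%:R)).
Proof.
rewrite /Pj1 addKn big_mkord mulr_sumr; apply: eq_bigr => l _.
rewrite -Pj1_inner big_mkord !mulr_sumr; apply: eq_bigr => m _.
rewrite aE inc_gamma_bracket; last by rewrite divr_ge0// mulr_ge0.
rewrite (_ : (r.+2.-1 - m).-1 = (r - m)%N); last by lia.
by ring.
Qed.

Lemma Pj2E r k :
  Pj2 Nt L r.+2 alpha (r.+2 + k) =
  \sum_(l < k.+1) ((1 - r.+2%:R) / L%:R) ^+ r.+2 * expR (- c) / (r.+2%:R - 1) ^+ 2 *
    beta R L r.+2 (r.+2 + k) l / l.+1%:R ^+ r.+2 *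
    ((-1) ^+ r * ((r.+2%:R / r.+1%:R) ^+ r.+1 - 1) *
     gamma_conv r (c * l.+1%:R / r.+2%:R)).
Proof.
rewrite /Pj2 addKn big_mkord mulr_sumr; apply: eq_bigr => l _.
rewrite -Pj2_inner big_mkord !mulr_sumr; apply: eq_bigr => m _.
rewrite big_mkord !mulr_sumr; apply: eq_bigr => n _.
rewrite aE.
rewrite (_ : L%:R * alpha * l.+1%:R / Nt%:R = r.+2%:R * (c * l.+1%:R / r.+2%:R)); last first.
  by rewrite mulrCA divff ?mulr1 ?pnatr_eq0// /Defs.cst; ring.
have a0 : 0 <= c * l.+1%:R / r.+2%:R by rewrite divr_ge0// mulr_ge0.
rewrite -[X in X / (m - n).+1%:R]opprB (inc_gamma_bracket _ _ _ a0).
rewrite (_ : (r.+2.-1 - m).-1 = (r - m)%N); last by lia.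
rewrite (_ : (r.+2 - n).-1 = (r.+1 - n)%N); last by lia.
have -> : r.+2%:R - 1 = r.+1%:R :> R by rewrite -[r.+2%:R]natr1 addrK.
by rewrite [(r.+1%:R ^+ m * _)^-1]invfM; ring.
Qed.

(** The two sides agree for each [l] separately. After the cancellation between [Pj1] and [Pj2], the
    remaining [(r+2)^(r+1)] is the power produced by the change of scale in
    [rint_stop_dens_term]. *)
Lemma stop_prob_Pj r k :
  stop_prob r.+1 (r.+2 + k) c =
  (Pj1 Nt L r.+2 alpha (r.+2 + k) + Pj2 Nt L r.+2 alpha (r.+2 + k))%:E.
Proof.
rewrite stop_probE// rintE; last by rewrite /stop_dens; cont.
congr (_%:E); rewrite (eq_rint _ (stop_dens_expand r.+1 k c)) rintZ; last first.
  by apply: continuous_sumr => l; cont.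
rewrite -rint_sum; last by move=> l; cont.
rewrite Pj1E Pj2E -big_split/= mulr_sumr; apply: eq_bigr => l _.
rewrite rint_stop_dens_term// -/(gamma_conv _ _); move: (gamma_conv _ _) => J.
have lk : (l <= k)%N by rewrite -ltnS.
have n0 n : n.+1%:R != 0 :> R by rewrite pnatr_eq0.
have f0 n : n`!%:R != 0 :> R by rewrite pnatr_eq0 -lt0n fact_gt0.
have -> : 1 - r.+2%:R = - r.+1%:R :> R by rewrite -[r.+2%:R]natr1; ring.
have -> : r.+2%:R - 1 = r.+1%:R :> R by rewrite -[r.+2%:R]natr1 addrK.
have Lr0 : L%:R != 0 :> R by rewrite pnatr_eq0 -lt0n.
have bE : 'C(k, l)%:R = k`!%:R / (l`!%:R * (k - l)`!%:R) :> R.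
  by rewrite -(bin_fact lk) !natrM mulfK// mulf_neq0.
rewrite /beta bE !addKn.
rewrite [r.+2.-1]/= [r.+2.-2]/= factS [(r.+1 * _)%:R]natrM.
have sgnE : (-1) ^+ r.+2 = (-1) ^+ r :> R by rewrite !exprS !mulN1r opprK.
rewrite !expr_div_n [(- r.+1%:R) ^+ r.+2]exprNn sgnE [l.+1%:R ^+ r.+2]exprS [r.+1%:R ^+ r.+2]exprS.
have P0 : r.+1%:R ^+ r.+1 != 0 :> R by rewrite expf_neq0.
have q0 : l.+1%:R ^+ r.+1 != 0 :> R by rewrite expf_neq0.
have LL0 : L%:R ^+ r.+2 != 0 :> R by rewrite expf_neq0.
move: (n0 r) (n0 l) (f0 k) (f0 l) (f0 (k - l)%N) (f0 r).
move: (r.+1%:R ^+ r.+1 : R) P0 (l.+1%:R ^+ r.+1 : R) q0 (r.+2%:R ^+ r.+1 : R)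
  (L%:R ^+ r.+2 : R) LL0 => P P0 q q0 W LL LL0.
move: (r.+1%:R : R) (l.+1%:R : R) (k`!%:R : R) (l`!%:R : R) ((k - l)`!%:R : R)
  (r`!%:R : R) ((r.+2 + k)`!%:R : R) (expR (- c)) ((-1) ^+ l : R)
  => rho lam kf lf klf rf jf e sl rho0 lam0 kf0 lf0 klf0 rf0.
(* Powers and factorials are now independent nonzero reals, so the identity is rational. The sign
   [(-1)^r] occurs squared, once from [(1 - NRF)^NRF] and once from the inner sums; a parity split
   removes it. *)
by rewrite -signr_odd; case: (odd r); rewrite ?expr0 ?expr1 /=; field;
  rewrite P0 q0 LL0 rho0 lam0 kf0 lf0 klf0 rf0.
Qed.

End stop_prob_formula.

(** * The training length as a first passage *)

Section first_index.
Context {R : realType}.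
Implicit Types (A : nat -> R) (c : R) (L k : nat).

(** The index counts from 0 and refers to the passage from [A k] to [A k.+1]; the value [L] means
    that no passage occurs. *)
Definition first_index A c L : nat := find (fun k => c < A k.+1) (iota 0 L).

Lemma first_index_le_bound A c L : (first_index A c L <= L)%N.
Proof. by rewrite -[L in leqRHS](size_iota 0) find_size. Qed.

Lemma first_indexP A c L : (first_index A c L < L)%N -> c < A (first_index A c L).+1.
Proof.
move=> KL; have := @nth_find _ 0%N (fun k => c < A k.+1) (iota 0 L).
by rewrite -/(first_index A c L) nth_iota// add0n; apply; rewrite has_find size_iota.
Qed.

Lemma before_first_index A c L k : (k < first_index A c L)%N -> A k.+1 <= c.
Proof.
move=> kK; have := @before_find _ 0%N (fun k => c < A k.+1) (iota 0 L) k kK.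
by rewrite nth_iota ?(leq_trans kK (first_index_le_bound _ _ _))// add0n => /negbT; rewrite -leNgt.
Qed.

Lemma le_first_index A c L k : A 0%N <= c -> (k <= first_index A c L)%N -> A k <= c.
Proof. by move=> A0; case: k => [//|k]; exact: before_first_index. Qed.

Lemma first_index_eq A c L k : (forall i, A i <= A i.+1) -> A 0%N <= c -> (k < L)%N ->
  (A k <= c) && (c < A k.+1) = (k == first_index A c L).
Proof.
move=> Amono A0 kL.
have Ale i j : (i <= j)%N -> A i <= A j.
  move=> ij; rewrite -(subnK ij); elim: (j - i)%N => [|d IH] //.
  by rewrite addSn (le_trans IH).
apply/andP/eqP => [[Ak kA]|kK].
  case: (ltngtP k (first_index A c L)) => // [kK|Kk].
    by have := before_first_index kK; rewrite leNgt kA.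
  have cK := @first_indexP A c L (ltn_trans Kk kL).
  by move: (lt_le_trans cK (Ale _ _ Kk)); rewrite ltNge Ak.
split; first by rewrite (le_first_index (L := L))// kK.
by rewrite kK first_indexP// -kK.
Qed.

(** Monotonicity makes the crossing unique, so a function of the first passage becomes linear in
    crossing indicators, whose expectations are the stopping probabilities. *)
Lemma sum_first_index A c L (w : nat -> R) :
  (forall i, A i <= A i.+1) -> A 0%N <= c ->
  \sum_(k < L) w k * ((A k <= c) && (c < A k.+1))%:R =
  if (first_index A c L < L)%N then w (first_index A c L) else 0.
Proof.
move=> Amono A0; set K := first_index _ _ _.
rewrite (eq_bigr (fun k : 'I_L => w k * (k == K :> nat)%:R)); last first.
  by move=> k _; rewrite (first_index_eq Amono A0 (ltn_ord k)).
case: ltnP => [KL|LK].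
  rewrite (bigD1 (Ordinal KL))//= eqxx mulr1 big1 ?addr0// => k kK.
  by rewrite (_ : (k == K :> nat) = false) ?mulr0//; apply/negbTE.
rewrite big1// => k _; rewrite ltn_eqF ?mulr0//.
exact: leq_trans (ltn_ord k) LK.
Qed.

End first_index.

Lemma sorted_nth_leq (p : seq nat) i j : sorted ltn p -> (i <= j < size p)%N ->
  (nth 0 p i <= nth 0 p j)%N.
Proof.
move=> sp /andP[ij jp]; have lp : sorted leq p by apply: sub_sorted sp => x y /ltnW.
by apply: (sorted_leq_nth leq_trans leqnn 0%N lp) => //; rewrite inE// (leq_ltn_trans ij).
Qed.

Section train_len.
Context {R : realType}.
Implicit Types (s : seq R) (g : seq (R * R)) (N i k : nat).

Lemma tops_take_mono s N k : tops (take k s) N <= tops (take k.+1 s) N.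
Proof.
have [ks|sk] := ltnP k (size s); last by rewrite !take_oversize// leqW.
rewrite (take_nth 0 ks).
have -> : tops (rcons (take k s) (nth 0 s k)) N = tops (nth 0 s k :: take k s) N.
  by apply: tops_perm; rewrite perm_rcons.
exact: tops_le_cons.
Qed.

Lemma tops_filter_neq0 s N : all (>= 0) s -> tops [seq x <- s | x != 0] N = tops s N.
Proof.
elim: s N => [|x s IH] [|N] //; rewrite ?tops0//.
move=> xs0; have /andP[x0 s0] : (0 <= x) && all (>= 0) s by [].
rewrite /=; have [->|_] := eqVneq x 0; rewrite /= !IH//.
by rewrite add0r; apply/esym/max_idPl/tops_mono.
Qed.

Lemma tops_scale (a : R) s N : 0 <= a -> tops (map (fun x => a * x) s) N = a * tops s N.
Proof.
move=> a0; elim: s N => [|x s IH] [|N] //=; rewrite ?mulr0//.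
by rewrite !IH maxr_pMr// mulrDr.
Qed.

Lemma sqnorm_ge0 (z : R * R) : 0 <= sqnorm z.
Proof. by rewrite /sqnorm addr_ge0// sqr_ge0. Qed.

Lemma sqnorm_eq0 (z : R * R) : (sqnorm z == 0) = (z == (0, 0)).
Proof. by case: z => x y; rewrite /sqnorm paddr_eq0 ?sqr_ge0// !sqrf_eq0. Qed.

(** Two strictly increasing lists with the same elements coincide. Consequently the coefficients
    trained up to step [i] form a prefix of the list of support coefficients. *)
Lemma take_find_sorted (p : seq nat) i : sorted ltn p -> all (leq 1) p ->
  [seq l <- iota 1 i | l \in p] = take (find (fun l => i < l)%N p) p.
Proof.
move=> sp p1; set k := find _ _.
apply: (irr_sorted_eq ltn_trans ltnn).
- by apply: sorted_filter; [exact: ltn_trans|exact: iota_ltn_sorted].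
- exact: take_sorted.
move=> l; rewrite mem_filter mem_iota add1n ltnS.
apply/idP/idP => [/andP[lp /andP[l1 li]]|lk].
  have ip : (index l p < size p)%N by rewrite index_mem.
  have ik : (index l p < k)%N.
    rewrite ltnNge; apply/negP => ki.
    have hp : has (fun l => i < l)%N p by rewrite has_find (leq_ltn_trans ki).
    have := nth_find 0%N hp; rewrite -/k ltnNge => /negP; apply.
    by rewrite (leq_trans _ li)// -[l in leqRHS](nth_index 0%N lp) sorted_nth_leq// ki.
  rewrite -(nth_index 0%N lp) -(nth_take 0%N ik) mem_nth// size_take.
  by case: ifP => // _; exact: index_mem.
have lp := mem_take lk; rewrite lp (allP p1)//= leqNgt.
have ik : (index l (take k p) < k)%N.
  by rewrite (leq_trans (n := size (take k p))) ?index_mem// size_take_min geq_minl.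
have := before_find 0%N ik.
by rewrite -(nth_take 0%N ik) nth_index// => ->.
Qed.

Definition positions Nt (I : {set 'I_Nt}) : seq nat := [seq (val j).+1 | j <- enum I].

Lemma sorted_positions Nt (I : {set 'I_Nt}) : sorted ltn (positions I).
Proof.
have sub : subseq (enum I) (enum 'I_Nt) by rewrite [enum 'I_Nt]enumT; exact: filter_subseq.
apply: (subseq_sorted ltn_trans (map_subseq (fun j : 'I_Nt => (val j).+1) sub)).
by rewrite (map_comp succn val) val_enum_ord -(iotaDl 1 0) iota_ltn_sorted.
Qed.

Lemma positions_gt0 Nt (I : {set 'I_Nt}) : all (leq 1) (positions I).
Proof. by apply/allP => _ /mapP[k _ ->]. Qed.

Lemma size_positions Nt (I : {set 'I_Nt}) : size (positions I) = #|I|.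
Proof. by rewrite size_map -cardE. Qed.

Lemma positions_le Nt (I : {set 'I_Nt}) k : (k < #|I|)%N ->
  (0 < nth 0 (positions I) k <= Nt)%N.
Proof.
move=> kI; have := mem_nth 0%N (s := positions I) (n := k).
rewrite size_positions => /(_ kI) /mapP[j _ ->] /=.
exact: ltn_ord.
Qed.

(** [Bsq] selects the nonzero coefficients, the prefix selects those on the support. The two lists
    differ only by zeros, which [tops] ignores. *)
Lemma topsum_Bsq Nt (I : {set 'I_Nt}) g N i : size g = #|I| ->
  topsum N (Bsq (chan I g) i) =
  tops (take (find (fun l => i < l)%N (positions I)) [seq sqnorm z | z <- g]) N.
Proof.
move=> gI; set p := positions I.
have hp : [seq chan I g l | l <- p] = g.
  apply: (@eq_from_nth _ (0, 0)); rewrite size_map size_positions ?gI// => k kI.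
  have kp : (k < size p)%N by rewrite size_positions.
  rewrite (nth_map 0%N)// /chan -/(positions I) -/p mem_nth// index_uniq//.
  exact: sorted_uniq ltn_trans ltnn _ (sorted_positions I).
have -> : Bsq (chan I g) i = [seq x <- [seq sqnorm (chan I g l) |
    l <- [seq l <- iota 1 i | l \in p]] | x != 0].
  rewrite /Bsq filter_map; congr map; rewrite -filter_predI; apply: eq_filter => l /=.
  rewrite sqnorm_eq0; case: (boolP (l \in p)); rewrite ?andbT// => lp.
  by rewrite /chan -/(positions I) -/p (negbTE lp) eqxx.
have s0 (q : seq nat) : all (>= 0) [seq sqnorm (chan I g l) | l <- q].
  by apply/allP => _ /mapP[l _ ->]; exact: sqnorm_ge0.
rewrite topsumE; last first.
  by apply/allP => x; rewrite mem_filter => /andP[_]; exact: (allP (s0 _)).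
rewrite tops_filter_neq0// take_find_sorted ?sorted_positions ?positions_gt0//.
by rewrite map_comp map_take hp map_take.
Qed.

Definition stop_index N c L s : nat :=
  first_index (fun k => tops (take k s) N) c L.

Lemma nth0_filter_iota (P : pred nat) d n i0 : (0 < i0 <= n)%N -> P i0 ->
  (forall i, (0 < i < i0)%N -> ~~ P i) -> nth d [seq i <- iota 1 n | P i] 0 = i0.
Proof.
move=> /andP[i0_gt0 i0n] Pi0 notP.
rewrite (_ : n = (i0.-1 + (n - i0.-1))%N); last by lia.
rewrite iotaD filter_cat (_ : [seq i <- iota 1 i0.-1 | P i] = [::]); last first.
  apply/eqP; rewrite -[_ == _]negbK -has_filter; apply/hasPn => i.
  by rewrite mem_iota => ii0; apply: notP; lia.
rewrite (_ : (n - i0.-1)%N = (n - i0).+1); last by lia.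
by rewrite /= add1n prednK// Pi0.
Qed.

(* A vanishing coefficient on the support is harmless: it leaves [tops] unchanged,
   hence cannot be the first passage above the threshold. *)
Lemma train_lenE Nt (I : {set 'I_Nt}) g N (alpha : R) : size g = #|I| -> 0 <= alpha ->
  let K := stop_index N (alpha / Nt%:R) #|I| [seq sqnorm z | z <- g] in
  train_len Nt N alpha (chan I g) =
  if (K < #|I|)%N then nth 0%N (positions I) K else Nt.
Proof.
move=> gI a0 K; set s := [seq sqnorm z | z <- g] in K *; set c := alpha / Nt%:R in K *.
(* Since [p] is increasing, [m i] is the number of support positions that are at most [i]. *)
set p := positions I; set m := fun i => find (fun l => i < l)%N p.
have c0 : 0 <= c by rewrite divr_ge0.
have stE i : stops Nt N alpha (chan I g) i =
    (chan I g i != (0, 0)) && (c < tops (take (m i) s) N).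
  by rewrite /stops topsum_Bsq.
have Ale i j : (i <= j)%N -> tops (take i s) N <= tops (take j s) N.
  move=> ij; rewrite -(subnK ij); elim: (j - i)%N => [|d IH] //.
  by rewrite addSn (le_trans IH)// tops_take_mono.
have lowK k : (k <= K)%N -> tops (take k s) N <= c.
  by apply: (@le_first_index _ (fun k => tops (take k s) N)); rewrite take0.
rewrite /train_len; case: ltnP => [KI|IK]; last first.
  rewrite (_ : [seq i <- iota 1 Nt | stops Nt N alpha (chan I g) i] = [::])//.
  apply/eqP; rewrite -[_ == _]negbK -has_filter; apply/hasPn => i _.
  rewrite stE negb_and -leNgt; apply/orP; right; apply: lowK.
  by rewrite (leq_trans _ IK)// -size_positions find_size.
have Kp : (K < size p)%N by rewrite size_positions.
have cK : c < tops (take K.+1 s) N.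
  exact: (@first_indexP _ (fun k => tops (take k s) N)).
have sp := sorted_positions I.
apply: nth0_filter_iota; first exact: positions_le.
- rewrite stE; apply/andP; split.
    rewrite /chan -/(positions I) -/p mem_nth// index_uniq//; last first.
      exact: sorted_uniq ltn_trans ltnn _ sp.
    rewrite -sqnorm_eq0; apply/eqP => z0.
    have Ks : (K < size s)%N by rewrite size_map gI.
    move: cK; rewrite (take_nth 0 Ks) (nth_map (0, 0)) ?gI// z0.
    have := lowK K (leqnn _).
    rewrite -(tops_filter_neq0 N (s := take K s)); last first.
      by apply/allP => x /mem_take /mapP[z _ ->]; exact: sqnorm_ge0.
    rewrite -(tops_filter_neq0 N (s := rcons _ _)); last first.
      rewrite all_rcons lexx /=.
      by apply/allP => x /mem_take /mapP[z _ ->]; exact: sqnorm_ge0.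
    by rewrite filter_rcons eqxx /= leNgt => /negbTE ->.
  apply: (lt_le_trans cK); apply: Ale; rewrite ltnNge; apply/negP => mK.
  have hm : has (fun l => nth 0%N p K < l)%N p.
    by rewrite has_find (leq_ltn_trans mK).
  have := nth_find 0%N hm; rewrite -/(m _).
  by rewrite ltnNge sorted_nth_leq// mK.
move=> i /andP[i0 iK]; rewrite stE negb_and -leNgt; apply/orP; right; apply: lowK.
rewrite leqNgt; apply/negP => Km.
by have := before_find 0%N Km; rewrite iK.
Qed.

End train_len.

(** * Expected training length for a fixed support *)

Section expected_train_len.
Context {R : realType}.
Implicit Types (s : seq R) (n k M N : nat) (c : R).

Lemma eq_cn_expect L n (F G : seq (R * R) -> \bar R) :
  (forall g, size g = n -> F g = G g) -> cn_expect L n F = cn_expect L n G.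
Proof.
elim: n F G => [|n IH] F G FG /=; first exact: FG.
apply: eq_integral => x _; apply: eq_integral => y _; congr (_ * _)%E.
by apply: IH => g gn; apply: FG; rewrite /= gn.
Qed.

Lemma take_mkseq T (f : nat -> T) n k : take k (mkseq f n) = mkseq f (minn k n).
Proof. by rewrite /mkseq -map_take take_iota. Qed.

Lemma exp_expect_sum n (I : Type) (r : seq I) (f : I -> seq R -> R) :
  (forall i, measurable_seqfun n (fun s => (f i s)%:E)) ->
  (forall i s, 0 <= f i s) ->
  exp_expect n (fun s => (\sum_(i <- r) f i s)%:E) =
  (\sum_(i <- r) exp_expect n (fun s => (f i s)%:E))%E.
Proof.
move=> mf f0.
have mS q : measurable_seqfun n (fun s => (\sum_(i <- q) f i s)%:E).
  move=> d T a ma; apply/measurable_EFinP; apply: measurable_sum => i.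
  by have /measurable_EFinP := mf i d T a ma.
elim: r => [|i r IH].
  rewrite big_nil; under [X in exp_expect _ X]eq_fun do rewrite big_nil.
  exact: exp_expect_cst.
rewrite big_cons -IH -exp_expectD//.
- by congr exp_expect; apply/funext => s; rewrite big_cons EFinD.
- by move=> s; rewrite lee_fin.
- by move=> s; rewrite lee_fin sumr_ge0.
Qed.

Definition stop_ind N c k s : R :=
  ((tops (take k s) N <= c) && (c < tops (take k.+1 s) N))%:R.

Lemma measurable_stop_ind n N c k : measurable_seqfun n (fun s => (stop_ind N c k s)%:E).
Proof.
move=> d T a ma; apply/measurable_EFinP.
have mt j : measurable_fun setT (fun t => tops (take j (mkseq (a ^~ t) n)) N).
  by under eq_fun do rewrite take_mkseq; exact: measurable_tops.
rewrite [X in measurable_fun _ X](_ : _ = (fun t =>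
    if tops (take k (mkseq (a ^~ t) n)) N <= c then
    if c < tops (take k.+1 (mkseq (a ^~ t) n)) N then 1 else 0 else 0)); last first.
  by apply/funext => t; rewrite /stop_ind; case: leP => //= _; case: ltP.
apply: measurable_fun_ifT; last exact: measurable_cst.
  by apply: measurable_fun_ler; [exact: mt|exact: measurable_cst].
apply: measurable_fun_ifT; [|exact: measurable_cst|exact: measurable_cst].
by apply: measurable_fun_ltr; [exact: measurable_cst|exact: mt].
Qed.

Lemma exp_expect_stop_ind n M c k : (k < n)%N ->
  exp_expect n (fun s => (stop_ind M.+1 c k s)%:E) = stop_prob M k c.
Proof.
move=> kn; rewrite -exp_expect_stop.
rewrite -(@exp_expect_take _ k.+1 n (fun s =>
  (((tops (take k s) M.+1 <= c) && (c < tops s M.+1))%:R : R)%:E))//.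
by congr exp_expect; apply/funext => s; rewrite /stop_ind /= take_takel.
Qed.

(** The saving [Nt - T] is a weighted sum of crossing indicators, empty of contributions when
    training never terminates, in agreement with [T = Nt]. Scaling the squared moduli by [L] turns
    the threshold [alpha / Nt] into [c]. *)
Lemma cn_expect_train_len Nt M (I : {set 'I_Nt}) (alpha : R) (p : nat -> R) :
  (0 < Nt)%N -> (0 < #|I|)%N -> 0 <= alpha ->
  (forall k, (k < #|I|)%N -> stop_prob M k (Defs.cst Nt #|I| alpha) = (p k)%:E) ->
  cn_expect #|I| #|I| (fun g => (train_len Nt M.+1 alpha (chan I g))%:R%:E) =
  (Nt%:R - \sum_(k < #|I|) (Nt - nth 0%N (positions I) k)%:R * p k)%:E.
Proof.
move=> Nt0 L0 a0 pE; set L := #|I| in L0 pE *; set c := Defs.cst Nt L alpha in pE.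
have LR0 : 0 < L%:R :> R by rewrite ltr0n.
have c0 : 0 <= c by rewrite /c /Defs.cst divr_ge0// mulr_ge0.
pose A s k := tops (take k s) M.+1.
pose T s : nat := if (first_index (A s) c L < L)%N
  then nth 0%N (positions I) (first_index (A s) c L) else Nt.
pose w k : R := (Nt - nth 0%N (positions I) k)%:R.
have TE s : (T s)%:R = Nt%:R - \sum_(k < L) w k * stop_ind M.+1 c k s.
  rewrite /stop_ind -/(A s) (@sum_first_index _ (A s)).
  - rewrite /T; case: ifP => [kL|_]; last by rewrite subr0.
    have /andP[_ h] := positions_le kL.
    by rewrite /w natrB// opprB addrCA subrr addr0.
  - by move=> k; exact: tops_take_mono.
  - by rewrite /A take0.
have mw k : measurable_seqfun L (fun s => (w k * stop_ind M.+1 c k s)%:E).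
  move=> d U a ma; apply/measurable_EFinP/measurable_funM => //.
  by have /measurable_EFinP := @measurable_stop_ind L M.+1 c k d U a ma.
have w0 k s : 0 <= w k * stop_ind M.+1 c k s by rewrite mulr_ge0.
have mT : measurable_seqfun L (fun s => (T s)%:R%:E : \bar R).
  move=> d U a ma; apply/measurable_EFinP; under eq_fun do rewrite TE.
  apply: measurable_funB => //; apply: measurable_sum => k.
  by have /measurable_EFinP := mw k d U a ma.
transitivity (exp_expect L (fun s => (T s)%:R%:E : \bar R)).
  rewrite -(cn_expectE (n := L) L0 mT) //.
  apply: eq_cn_expect => g gL; rewrite train_lenE// /T; congr (_%:R%:E).
  have -> : stop_index M.+1 (alpha / Nt%:R) #|I| [seq sqnorm z | z <- g] =
    first_index (A [seq L%:R * sqnorm z | z <- g]) c L; last by [].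
  rewrite /stop_index /first_index; apply: eq_find => k /=.
  rewrite /A (map_comp (fun x => L%:R * x) (@sqnorm R)) -(map_take _ (fun x => L%:R * x)) tops_scale//.
  by rewrite /c /Defs.cst -mulrA ltr_pM2l.
(* [exp_expectD] concerns nonnegative functions, so the saving is added to [T] and the subtraction
   is done afterwards, between finite quantities. *)
have H : (exp_expect L (fun s => (T s)%:R%:E : \bar R) +
    (\sum_(k < L) w k * p k)%:E = Nt%:R%:E)%E.
  rewrite -[RHS](@exp_expect_cst R L)//.
  rewrite (_ : (\sum_(k < L) _)%:E = exp_expect L (fun s =>
      (\sum_(k < L) w k * stop_ind M.+1 c k s)%:E)); last first.
    rewrite (@exp_expect_sum L _ _ (fun (k : 'I_L) s => w k * stop_ind M.+1 c k s))//.
    rewrite -sumEFin; apply: eq_bigr => k _.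
    under [X in exp_expect _ X]eq_fun do rewrite EFinM.
    rewrite exp_expectZ; [|exact: measurable_stop_ind|by move=> s; rewrite lee_fin|by rewrite lee_fin].
    by rewrite exp_expect_stop_ind// pE.
  rewrite -exp_expectD//.
  - by congr exp_expect; apply/funext => s; rewrite -EFinD TE subrK.
  - move=> d U a ma; apply/measurable_EFinP; apply: measurable_sum => k.
    by have /measurable_EFinP := mw k d U a ma.
  - by move=> s; rewrite lee_fin sumr_ge0.
by rewrite EFinB -H addeK.
Qed.

End expected_train_len.

Local Close Scope classical_set_scope.

(** * Counting supports *)

Section counting.
Implicit Types (n k L j : nat).

Lemma card_ord_lt n k : (k <= n)%N -> #|[set i : 'I_n | (i < k)%N]| = k.
Proof.
move=> kn; rewrite -sum1_card (eq_bigl (fun i : 'I_n => (i < k)%N)); last first.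
  by move=> i; rewrite inE.
by rewrite -(big_ord_widen _ (fun=> 1%N) kn) sum1_card card_ord.
Qed.

Lemma card_ord_gt n (i : 'I_n) : #|[set j : 'I_n | (i < j)%N]| = (n - i.+1)%N.
Proof.
have -> : [set j : 'I_n | (i < j)%N] = ~: [set j : 'I_n | (j < i.+1)%N].
  by apply/setP => j; rewrite !inE ltnS -ltnNge.
by rewrite cardsCs finset.setCK card_ord_lt ?card_ord// ltn_ord.
Qed.

Lemma sorted_nth_ltn (p : seq nat) i j : sorted ltn p -> (i < j < size p)%N ->
  (nth 0 p i < nth 0 p j)%N.
Proof.
move=> sp /andP[ij jp].
by apply: (sorted_ltn_nth ltn_trans 0%N sp) => //; rewrite inE// (ltn_trans ij).
Qed.

Lemma nth_positions n (I : {set 'I_n}) (k : 'I_#|I|) :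
  nth 0 (positions I) k = (enum_val k).+1.
Proof.
rewrite /positions (nth_map (enum_val k)); last by rewrite -cardE.
by rewrite -enum_val_nth.
Qed.

Lemma card_below_enum_val n (I : {set 'I_n}) (k : 'I_#|I|) :
  #|[set j in I | (j < enum_val k)%N]| = k.
Proof.
have -> : [set j in I | (j < enum_val k)%N] =
    [set enum_val r | r in [set r : 'I_#|I| | (r < k)%N]].
  have ltE (r : 'I_#|I|) : (enum_val r < enum_val k)%N = (r < k)%N.
    rewrite -ltnS -!nth_positions; have sp := sorted_positions I.
    have sz (q : 'I_#|I|) : (q < size (positions I))%N by rewrite size_positions.
    case: (ltnP r k) => rk; first by rewrite sorted_nth_ltn// rk sz.
    by apply/negbTE; rewrite -leqNgt sorted_nth_leq// rk sz.
  apply/setP => j; apply/idP/imsetP => [|[r]].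
    rewrite inE => /andP[jI jk]; exists (enum_rank_in jI j); last by rewrite enum_rankK_in.
    by rewrite inE -ltE enum_rankK_in.
  by rewrite !inE => rk ->; rewrite enum_valP ltE.
by rewrite card_imset ?card_ord_lt//; [exact/ltnW|exact: enum_val_inj].
Qed.

Lemma sum_positions (V : nmodType) n (I : {set 'I_n}) (f : nat -> nat -> V) :
  \sum_(k < #|I|) f (nth 0 (positions I) k) k =
  \sum_(i in I) f i.+1 #|[set j in I | (j < i)%N]|.
Proof.
rewrite [RHS]big_enum_val; apply: eq_bigr => k _.
by rewrite nth_positions card_below_enum_val.
Qed.

(** Such a set is [i] together with [j] elements below it and [L - j - 1] above it. The map [F]
    reassembles the pieces and is injective because intersecting with [lo] and [hi] recovers
    them. *)
Lemma card_sets_at n (i : 'I_n) L j : (j < L)%N ->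
  #|[set I : {set 'I_n} | [&& #|I| == L, i \in I & #|[set k in I | (k < i)%N]| == j]]| =
  ('C(i, j) * 'C(n - i.+1, L - j.+1))%N.
Proof.
move=> jL; set lo := [set k : 'I_n | (k < i)%N]; set hi := [set k : 'I_n | (i < k)%N].
have loE (I : {set 'I_n}) : [set k in I | (k < i)%N] = I :&: lo by apply/setP => k; rewrite !inE.
have ilo : i \notin lo by rewrite inE ltnn.
have ihi : i \notin hi by rewrite inE ltnn.
have disj : lo :&: hi = finset.set0.
  by apply/setP => k; rewrite !inE; case: ltngtP.
pose A := [set B : {set 'I_n} | B \subset lo & #|B| == j].
pose B := [set B : {set 'I_n} | B \subset hi & #|B| == (L - j.+1)%N].
pose F (p : {set 'I_n} * {set 'I_n}) := i |: (p.1 :|: p.2).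
have Flo (p : {set 'I_n} * {set 'I_n}) : p.1 \subset lo -> p.2 \subset hi -> F p :&: lo = p.1.
  move=> p1 p2; rewrite /F !finset.setIUl (finset.setIidPl p1).
  rewrite (_ : [set i] :&: lo = finset.set0); last first.
    by apply/eqP; rewrite setI_eq0 disjoints1.
  rewrite (_ : p.2 :&: lo = finset.set0) ?finset.set0U ?finset.setU0//.
  by apply/eqP; rewrite -finset.subset0 -disj finset.setIC finset.setIS.
have Fhi (p : {set 'I_n} * {set 'I_n}) : p.1 \subset lo -> p.2 \subset hi -> F p :&: hi = p.2.
  move=> p1 p2; rewrite /F !finset.setIUl (finset.setIidPl p2).
  rewrite (_ : [set i] :&: hi = finset.set0); last first.
    by apply/eqP; rewrite setI_eq0 disjoints1.
  rewrite (_ : p.1 :&: hi = finset.set0) ?finset.set0U ?finset.setU0//.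
  by apply/eqP; rewrite -finset.subset0 -disj finset.setSI.
have FI (I : {set 'I_n}) : i \in I -> F (I :&: lo, I :&: hi) = I.
  move=> iI; apply/setP => k; rewrite !inE.
  have [->|ki] := eqVneq k i; first by rewrite iI.
  by rewrite -andb_orr; case: ltngtP ki => [||/val_inj ->]; rewrite ?andbT// eqxx.
have cF (p : {set 'I_n} * {set 'I_n}) : p.1 \subset lo -> p.2 \subset hi -> #|F p| = (#|p.1| + #|p.2|).+1.
  move=> p1 p2; rewrite /F cardsU1 cardsU.
  have -> : p.1 :&: p.2 = finset.set0 by apply/eqP; rewrite -finset.subset0 -disj finset.setISS.
  rewrite cards0 subn0 inE negb_or (contra (fintype.subsetP p1 i))// (contra (fintype.subsetP p2 i))//.
have -> : [set I : {set 'I_n} | [&& #|I| == L, i \in I & #|[set k in I | (k < i)%N]| == j]] =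
    F @: finset.setX A B.
  apply/setP => I; rewrite inE loE; apply/idP/imsetP.
    case/and3P => /eqP IL iI /eqP Ij.
    exists (I :&: lo, I :&: hi); last by rewrite FI.
    rewrite !inE /= !subsetIr Ij eqxx /=.
    have := cF (I :&: lo, I :&: hi); rewrite FI// /= !subsetIr IL Ij => /(_ isT isT) ->.
    by rewrite -addSn addKn.
  case=> -[P Q]; rewrite !inE /= => /andP[/andP[Plo /eqP Pj] /andP[Qhi /eqP QL]] ->.
  by rewrite (Flo (P, Q))// (cF (P, Q))//= Pj QL eqxx /F !inE eqxx -addSn subnKC ?eqxx.
rewrite card_in_imset; last first.
  move=> [P Q] [P' Q']; rewrite !inE /=.
  move=> /andP[/andP[Plo _] /andP[Qhi _]] /andP[/andP[Plo' _] /andP[Qhi' _]] FE.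
  have := Flo (P, Q) Plo Qhi; rewrite FE Flo//= => ->.
  by have := Fhi (P, Q) Plo Qhi; rewrite FE Fhi//= => ->.
by rewrite cardsX !cards_draws card_ord_lt ?card_ord_gt// ltnW.
Qed.

Lemma card_sets_eq n L : #|[set I : {set 'I_n} | #|I| == L]| = 'C(n, L).
Proof. by rewrite card_draws card_ord. Qed.

Lemma sum_sets_positions (R : pzRingType) n L (f : nat -> nat -> R) :
  \sum_(I : {set 'I_n} | #|I| == L) \sum_(k < #|I|) f (nth 0%N (positions I) k) k =
  \sum_(i < n) \sum_(j < L) f i.+1 j * ('C(i, j) * 'C(n - i.+1, L - j.+1))%:R.
Proof.
transitivity (\sum_(I : {set 'I_n} | #|I| == L) \sum_(i in I) \sum_(j < L)
    f i.+1 j * (#|[set k in I | (k < i)%N]| == j)%:R).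
  apply: eq_bigr => I /eqP IL; rewrite sum_positions; apply: eq_bigr => i iI.
  have lt : (#|[set k in I | (k < i)%N]| < L)%N.
    rewrite -IL; apply: proper_card; apply/properP; split.
      by apply/fintype.subsetP => k; rewrite inE => /andP[].
    by exists i => //; rewrite inE ltnn andbF.
  rewrite (bigD1 (Ordinal lt))//= eqxx mulr1 big1 ?addr0// => k kK.
  by rewrite (_ : (_ == _ :> nat) = false) ?mulr0//; apply/negbTE; rewrite eq_sym.
rewrite (exchange_big_dep predT)//=; apply: eq_bigr => i _.
rewrite exchange_big; apply: eq_bigr => j _.
rewrite -(card_sets_at i (ltn_ord j)) -sum1_card natr_sum mulr_sumr.
rewrite [RHS]big_mkcond [LHS]big_mkcond; apply: eq_bigr => I _.
rewrite inE; case: (#|I| == L); rewrite /= ?andbF//.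
by case: (i \in I) => //=; case: eqP; rewrite ?mulr0.
Qed.

End counting.

Local Open Scope classical_set_scope.

(** * Assembling the average training length *)

Section formula.
Context {R : realType}.
Local Notation mu := (@lebesgue_measure R).
Implicit Types (c : R) (i j k : nat).

(** For [NRF = 1] the sum of the largest is the maximum: [k] variables stay at or below [c] and the
    next exceeds it. The case is separate because [Pj1] and [Pj2] divide by [NRF - 1]; here the
    polynomial factor of [stop_dens] is 1 and its antiderivative is explicit. *)
Lemma stop_prob_one k c : 0 <= c ->
  stop_prob 0 k c = (expR (- c) * (1 - expR (- c)) ^+ k)%:E.
Proof.
move=> c0; case: k => [|k].
  by rewrite stop_prob_small// expr0 fact0 divr1.
rewrite -[k.+1]add1n stop_probE// divr1.
transitivity (\int[mu]_(v in `[0%R, c])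
    ((k.+1%:R * expR (- c)) * (expR (- v) * (1 - expR (- v)) ^+ k))%:E)%E.
  have f0 : k`!%:R != 0 :> R by rewrite pnatr_eq0 -lt0n fact_gt0.
  apply: eq_integral => v _; rewrite /stop_dens add1n factS natrM fact0 expr0.
  by congr (_%:E); field.
have cf : continuous (fun v => k.+1%:R * expR (- c) * (expR (- v) * (1 - expR (- v)) ^+ k)).
  by cont.
have dF v : is_derive v (1 : R) (fun v => expR (- c) * (1 - expR (- v)) ^+ k.+1)
    (k.+1%:R * expR (- c) * (expR (- v) * (1 - expR (- v)) ^+ k)).
  have h1 : is_derive v (1 : R) (fun v : R => 1 - expR (- v)) (expR (- v)).
    by apply: is_derive_eq; rewrite /GRing.scale/=; ring.
  have h2 := is_deriveZ (expR (- c)) (is_deriveX k h1).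
  rewrite (_ : (fun x => _) = expR (- c) \*: ((fun v : R => 1 - expR (- v)) ^+ k.+1)); last first.
    by apply/funext => x; rewrite /= fctE.
  by apply: is_derive_eq; rewrite /GRing.scale/=; ring.
by rewrite (integral_FTC c0 cf dF) oppr0 expR0 subrr expr0n/= mulr0 subr0.
Qed.

Lemma big_nat_ord_cond (F : nat -> R) (m n K : nat) : (n <= K)%N ->
  \sum_(m <= j < n) F j = \sum_(j < K) (if (m <= j < n)%N then F j else 0).
Proof.
move=> nK; rewrite (big_nat_widen _ _ _ _ _ nK) (big_nat_widenl _ 0)// big_mkord big_mkcond.
by apply: eq_bigr => j _; rewrite /= andbC.
Qed.

Variables (Nt L NRF : nat) (alpha : R).
Hypotheses (Nt0 : (0 < Nt)%N) (L0 : (0 < L)%N) (LNt : (L <= Nt)%N).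
Hypotheses (NRF0 : (0 < NRF)%N) (NRFL : (NRF <= L)%N) (alpha0 : 0 < alpha).

Local Notation c := (Defs.cst Nt L alpha).

Let c0 : 0 <= c.
Proof. by rewrite /Defs.cst divr_ge0// mulr_ge0// ltW. Qed.

Definition pstop k : R :=
  if NRF == 1%N then expR (- c) * (1 - expR (- c)) ^+ k
  else if (k < NRF)%N then c ^+ k * expR (- c) / k`!%:R
  else Pj1 Nt L NRF alpha k + Pj2 Nt L NRF alpha k.

Lemma stop_prob_pstop k : stop_prob NRF.-1 k c = (pstop k)%:E.
Proof.
rewrite /pstop; case: eqP => [->|N1]; first exact: stop_prob_one.
have [r Nr] : exists r, NRF = r.+2.
  by exists NRF.-2; case: NRF NRF0 N1 => [|[|n]].
rewrite Nr; case: ltnP => kN.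
  by rewrite stop_prob_small//; congr (_%:E); ring.
by rewrite -(subnKC kN) stop_prob_Pj.
Qed.

(** Outside the range from [b1] to [b2] one of the two binomials in [xi] vanishes, so every sum in
    the formula can be extended to all [j < L]. *)
Lemma xi_eq0 i j : (0 < i < Nt)%N -> (j < L)%N -> ~~ (b1 Nt L i <= j <= b2 L i)%N ->
  xi R Nt L i j = 0.
Proof.
move=> /andP[i0 iNt] jL; rewrite /b1 /b2 negb_and -!ltnNge => jb.
have H : ((i.-1 < j) || (Nt - i < L - j.+1))%N by lia.
by rewrite /xi natrM; case/orP: H => h; rewrite (bin_small h) ?mulr0 !mul0r.
Qed.

Lemma sum_xi_pstop i : (0 < i < Nt)%N ->
  \sum_(j < L) xi R Nt L i j * pstop j = Pi Nt L NRF alpha i.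
Proof.
move=> i0Nt; have /andP[i0 iNt] := i0Nt; rewrite /Pi.
have b2L : ((b2 L i).+1 <= L)%N by rewrite /b2; lia.
case: (eqVneq i 1%N) => [i1|i1].
  rewrite (bigD1 (Ordinal L0))//= big1 ?addr0; last first.
    move=> j j0; rewrite xi_eq0 ?mul0r// /b2 i1 /=.
    have : (j != 0 :> nat) by [].
    by lia.
  have -> : pstop 0 = expR (- c).
    by rewrite /pstop !expr0 fact0 mulr1 mul1r divr1 NRF0; case: ifP.
  (* Only [j = 0] survives at [i = 1], with [xi = C(Nt-1,L-1) / C(Nt,L) = L / Nt]. *)
  congr (_ * _); rewrite /xi i1 bin0 mul1n !subn1.
  have bn0 : 'C(Nt, L)%:R != 0 :> R by rewrite pnatr_eq0 -lt0n bin_gt0.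
  have n0 : Nt%:R != 0 :> R by rewrite pnatr_eq0 -lt0n.
  apply/eqP; rewrite eqr_div// -!natrM; apply/eqP; congr (_%:R).
  by rewrite mulnC mul_bin_diag prednK// mulnC.
case: (eqVneq NRF 1%N) => [N1|N1].
  rewrite (big_nat_ord_cond _ _ b2L); apply: eq_bigr => j _.
  rewrite ltnS; case: ifPn => [_|jb].
    by rewrite /pstop N1 eqxx mulrA.
  by rewrite xi_eq0 ?mul0r.
rewrite (big_nat_ord_cond _ _ b2L).
have minL : ((minn NRF.-1 (b2 L i)).+1 <= L)%N by lia.
rewrite (big_nat_ord_cond _ _ minL) -big_split/=; apply: eq_bigr => j _.
case: (boolP (b1 Nt L i <= j <= b2 L i)%N) => jb; last first.
  rewrite xi_eq0// mul0r !ifF ?addr0//.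
    by apply/negbTE; apply: contra jb => /andP[]; lia.
  by apply/negbTE; apply: contra jb => /andP[]; lia.
rewrite /pstop (negbTE N1); case: ltnP => jN.
  rewrite ifT; last by lia.
  by rewrite ifF ?addr0//; apply/negbTE; lia.
rewrite ifF; last by apply/negbTE; lia.
by rewrite ifT ?add0r//; lia.
Qed.

Lemma avg_train_lenE : avg_train_len Nt L NRF alpha = (T_ITSU_formula Nt L NRF alpha)%:E.
Proof.
rewrite /avg_train_len.
transitivity ((\sum_(I : {set 'I_Nt} | #|I| == L)
   (Nt%:R - \sum_(k < #|I|) (Nt - nth 0%N (positions I) k)%:R * pstop k)%:E) *
   ('C(Nt, L)%:R^-1)%:E)%E.
  congr (_ * _)%E; apply: eq_bigr => I /eqP IL; rewrite -[in LHS]IL.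
  rewrite -[NRF in LHS](prednK NRF0); apply: cn_expect_train_len.
  - by [].
  - by rewrite IL.
  - exact: ltW.
  - by move=> k _; rewrite IL stop_prob_pstop.
rewrite sumEFin -EFinM; congr (_%:E).
rewrite sumrB (@sum_sets_positions R Nt L (fun i k => (Nt - i)%:R * pstop k)).
have bn0 : 'C(Nt, L)%:R != 0 :> R by rewrite pnatr_eq0 -lt0n bin_gt0.
rewrite (_ : \sum_(I : {set 'I_Nt} | #|I| == L) Nt%:R = Nt%:R * 'C(Nt, L)%:R); last first.
  rewrite -card_sets_eq -sum1_card natr_sum mulr_sumr.
  by apply: eq_big => [I|I _]; rewrite ?inE ?mulr1.
rewrite mulrBl mulfK// /T_ITSU_formula; congr (_ - _).
rewrite mulr_suml.
transitivity (\sum_(i < Nt) (Nt - i.+1)%:R * \sum_(j < L) xi R Nt L i.+1 j * pstop j).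
  apply: eq_bigr => i _; rewrite mulr_suml mulr_sumr; apply: eq_bigr => j _.
  by rewrite /xi /=; ring.
rewrite -(big_mkord xpredT (fun i => (Nt - i.+1)%:R * \sum_(j < L) xi R Nt L i.+1 j * pstop j)).
(* The term for the last beam has weight [Nt - Nt = 0], so the outer sum ends at [Nt - 1]. *)
rewrite -[Nt in LHS](prednK Nt0) big_nat_recr//= prednK// subnn mul0r addr0.
rewrite [RHS]big_add1; apply: eq_big_nat => i /andP[_ iN].
by rewrite sum_xi_pstop//; lia.
Qed.

End formula.

Theorem theorem1 (R : realType) (Nt L NRF : nat) (alpha : R) :
  (2 <= Nt)%N -> (1 <= L <= Nt)%N -> (1 <= NRF <= L)%N -> 0 < alpha ->
  avg_train_len Nt L NRF alpha = (T_ITSU_formula Nt L NRF alpha)%:E.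
Proof.
move=> Nt2 /andP[L0 LNt] /andP[NRF0 NRFL] alpha0.
by apply: avg_train_lenE => //; exact: leq_trans Nt2.
Qed.
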